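(* For every $p\in[0,1)$ the sets $$\{A\in\mathbf{K}([0,1]) : \dim_{\mathcal H}(A)>p\}\quad\text{and}\quad \{A\in\mathbf{K}([0,1]) : \dim_{\mathrm F}(A)>p\}$$ are $\boldsymbol{\Sigma}^0_2$-complete.
   Context: $\mathbf{K}([0,1])$ is the space of compact subsets of $[0,1]$ (including $\emptyset$) with the Vietoris topology, i.e. the topology generated by the sets $\{F : F\cap C=\emptyset\}$ ($C$ closed) and $\{F: F\cap U\neq\emptyset\}$ ($U$ open); it is Polish. For $A\subset\mathbb{R}$, the Hausdorff dimension is $\dim_{\mathcal H}(A)=\sup\{s\ge 0:\mathcal H^s(A)>0\}$, where $\mathcal H^s$ is $s$-dimensional Hausdorff measure. $\mathbb{P}(A)$ denotes the set of Borel probability measures on $\mathbb{R}$ with support included in $A$; $\widehat\mu(\xi)=\int e^{-i\xi x}\,d\mu(x)$. The Fourier dimension is $\dim_{\mathrm F}(A)=\sup\{s\in[0,1] : (\exists\mu\in\mathbb{P}(A))(\exists c>0)(\forall x\in\mathbb{R}, x\ne 0)\ |\widehat\mu(x)|\le c|x|^{-s/2}\}$. Convention: $\sup\emptyset=0$ in both definitions. Borel hierarchy: $\boldsymbol\Sigma^0_1$ are the open sets, $\boldsymbol\Pi^0_1$ the closed sets; $\boldsymbol\Sigma^0_\xi$ sets ($\xi>1$) are countable unions of sets each in some $\boldsymbol\Pi^0_{\eta}$ with $\eta<\xi$; $\boldsymbol\Pi^0_\xi$ sets are complements of $\boldsymbol\Sigma^0_\xi$ sets. For $A\subset X$, $B\subset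 Y$ write $A\le_W B$ if there is a continuous $f:X\to Y$ with $x\in A\iff f(x)\in B$. For $Y$ Polish, $B\subset Y$ is $\boldsymbol\Gamma$-hard if $A\le_W B$ for every $A\in\boldsymbol\Gamma(X)$ and every Polish $X$ having a basis of clopen sets; it is $\boldsymbol\Gamma$-complete if it is $\boldsymbol\Gamma$-hard and $B\in\boldsymbol\Gamma(Y)$. *)

(* Defs.v *)
From HB Require Import structures.
From mathcomp Require Import all_boot all_order all_algebra.
From mathcomp Require Import all_classical all_reals all_analysis.
From mathcomp Require Import borel_hierarchy complex.

Set Implicit Arguments.
Unset Strict Implicit.
Unset Printing Implicit Defensive.

Import Order.TTheory GRing.Theory Num.Theory.
Import numFieldNormedType.Exports.

Local Open Scope classical_set_scope.
Local Open Scope ring_scope.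

(** Hyperspace of the compact subsets of [D], including [set0]. *)
Record hyperspace (T : topologicalType) (D : set T) := Hyperspace {
  hyperspace_set :> set T ;
  hyperspace_compact : compact hyperspace_set ;
  hyperspace_sub : hyperspace_set `<=` D
}.

HB.instance Definition _ (T : topologicalType) (D : set T) :=
  gen_eqMixin (hyperspace D).
HB.instance Definition _ (T : topologicalType) (D : set T) :=
  gen_choiceMixin (hyperspace D).

(* [C] and [U] range over closed and open sets of the ambient space [T]: as
   [F] is included in [D], only [C `&` D] and [U `&` D] matter, and these are
   exactly the relatively closed and relatively open subsets of [D]. *)
Definition vietoris_subbase (T : topologicalType) (D : set T) :
    set (set (hyperspace D)) :=
  [set [set F : hyperspace D | F `&` C = set0] | C in [set C : set T | closed C]]
  `|`
  [set [set F : hyperspace D | F `&` U !=set0] | U in [set U : set T | open U]].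

HB.instance Definition _ (T : topologicalType) (D : set T) :=
  isSubBaseTopological.Build (hyperspace D) (@vietoris_subbase T D) id.

Definition K01 (R : realType) : topologicalType :=
  hyperspace (`[0, 1]%classic : set R).

Section Hausdorff.
Context {R : realType}.
Implicit Types (A U : set R) (s delta : R).
Local Open Scope ereal_scope.

(* [diam set0 = -oo]; [diam_pow] handles [set0] separately. *)
Definition diam U : \bar R :=
  ereal_sup [set r | exists x y, [/\ U x, U y & r = (`|x - y|%R)%:E]].

(* [diam U ^ s], where [set0] counts for 0 even when [s = 0], and [0 ^ 0 = 1]
   otherwise, so that the 0-dimensional measure is the counting measure. *)
Definition diam_pow s U : \bar R :=
  if U == set0 then 0 else poweR (diam U) s.

Definition hausdorff_premeasure s delta A : \bar R :=
  ereal_inf [set \sum_(0 <= i <oo) diam_pow s (U i) | U in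
    [set U : (set R)^nat |
      A `<=` \bigcup_i U i /\ forall i, diam (U i) <= delta%:E]].

Definition hausdorff_measure s A : \bar R :=
  ereal_sup [set hausdorff_premeasure s delta A | delta in
    [set delta : R | (0 < delta)%R]].

(* Adding 0 to the set encodes the convention that its supremum is 0 when it is
   empty ([ereal_sup set0 = -oo]). *)
Definition hausdorff_dim A : \bar R :=
  ereal_sup (0 |` [set s%:E | s in
    [set s : R | (0 <= s)%R /\ 0 < hausdorff_measure s A]]).

End Hausdorff.

Section Fourier.
Context {R : realType}.
Implicit Types (mu : probability (measurableTypeR R) R) (A : set R).

Definition expi (t : R) : complex R := Complex (cos t) (sin t).

Definition complex_integral mu (f : R -> complex R) : complex R :=
  Complex (\int[mu]_x complex.Re (f x)) (\int[mu]_x complex.Im (f x)).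

Definition fourier_transform mu (xi : R) : complex R :=
  complex_integral mu (fun x => expi (- (xi * x))).

Definition measure_support mu : set R :=
  [set x | forall U : set R, open U -> U x -> (0 < mu U)%E].

(* The library's [sup] takes the value 0 on [set0], as required. *)
Definition fourier_dim A : R :=
  sup [set s : R | 0 <= s <= 1 /\
    exists2 mu : probability (measurableTypeR R) R, measure_support mu `<=` A &
    exists2 c : R, 0 < c &
    forall x : R, x != 0 ->
      Normc.normc (fourier_transform mu x) <= c * `|x| `^ (- (s / 2))].

End Fourier.

Definition complete_compatible_metric (R : realType) (X : topologicalType)
    (d : X -> X -> R) :=
  [/\ forall x y, (d x y = 0) <-> (x = y),
      forall x y, d x y = d y x,
      forall x y z, d x z <= d x y + d y z,
      forall (x : X) (A : set X),
        nbhs x A <-> exists2 e, 0 < e & [set y | d x y < e] `<=` A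
    & forall u : X^nat,
        (forall e, 0 < e -> exists N : nat, forall m n : nat,
          (N <= m)%N -> (N <= n)%N -> d (u m) (u n) < e) ->
        exists l : X, u n @[n --> \oo] --> l].

Definition polish (R : realType) (X : topologicalType) :=
  (exists2 S : set X, countable S & dense S) /\
  (exists d : X -> X -> R, complete_compatible_metric d).

(* This is stronger than the library's [zero_dimensional], which only asks for
   points to be separated by clopen sets. *)
Definition clopen_basis (X : topologicalType) :=
  exists2 B : set (set X), B `<=` clopen & basis B.

Definition wadge_le (X Y : topologicalType) (A : set X) (B : set Y) :=
  exists2 f : X -> Y, continuous f & forall x, A x <-> B (f x).

Definition pointclass := forall X : topologicalType, set (set X).

(* In a topological space, being a countable union of sets in some Pi^0_eta with
   eta < 2 means being a countable union of closed sets. *)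
Definition Sigma02 : pointclass := fun X => [set A : set X | Fsigma A].

(* [R] only serves as the type of the real numbers in which metrics are valued. *)
Definition hard (R : realType) (Gamma : pointclass) (Y : topologicalType)
    (B : set Y) :=
  forall X : topologicalType, polish R X -> clopen_basis X ->
  forall A : set X, Gamma X A -> wadge_le A B.

Definition complete_for (R : realType) (Gamma : pointclass)
    (Y : topologicalType) (B : set Y) :=
  hard R Gamma B /\ Gamma Y B.

(* Main.v *)
Require Import Defs.
From HB Require Import structures.
From mathcomp Require Import all_boot all_order all_algebra.
From mathcomp Require Import all_classical all_reals all_analysis.
From mathcomp Require Import borel_hierarchy measurable_realfun complex ring lra.

Set Implicit Arguments.
Unset Strict Implicit.
Unset Printing Implicit Defensive.

Import Order.TTheory GRing.Theory Num.Theory.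
Import numFieldNormedType.Exports.

Local Open Scope classical_set_scope.
Local Open Scope ring_scope.

(** Hardness. Intervals have both dimensions equal to 1 and countable compact
    sets have both dimensions equal to 0. So it is enough to send a point of a
    given [Fsigma] set to a compact set containing an interval, and every other
    point to a countable one, whatever [p < 1] is
    ([hard_of_countable_interval]). The [n]-th closed piece [F n] governs the
    part of the image inside [2^-(n+1), 2^-n]. That part is the whole interval
    when the point is in [F n], and otherwise a dyadic grid, which gets finer as
    the point gets closer to [F n]; the closeness is measured by a sequence of
    clopen sets exhausting the complement of [F n].

    Upper bounds. The condition that the dimension exceeds [p] is
    written as a countable union of closed conditions.

    - Hausdorff dimension. [H^s(A) > 0] holds iff the covers of [A] by balls
      have total [s]-cost bounded away from 0. Failing such a bound is witnessed
      by one cover by open balls, which still covers the nearby compact sets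
      ([closed_cover_resistant]).

    - Fourier dimension. With [s] and [c] fixed, the compact sets carrying a
      probability measure with [|mu^(xi)| <= c |xi|^(-s/2)] form a closed set
      ([closed_quantile_decay]), by weak compactness. Here a probability
      measure on [0, 1] is replaced by its quantile function, a nondecreasing
      [q] that pushes the uniform law forward to it and takes its values in the
      support. Quantile functions have pointwise limits along ultrafilters;
      monotonicity, the values in the limit compact set and the integrals of
      Lipschitz functions all pass to the limit, the integrals because their
      Riemann sums along a monotone [q] converge at a rate that does not depend
      on [q] ([quantile_mean_riemann]).

    An interval has Fourier dimension 1 because the transform of its uniform law
    is [O(1 / |xi|)]. A countable set has Fourier dimension 0 because a measure
    whose transform vanishes at infinity has no atoms
    ([quantile_decay_no_atom]). *)

(** * The Vietoris topology *)

Lemma open_vietoris_miss (T : topologicalType) (D C : set T) :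
  closed C -> open [set F : hyperspace D | F `&` C = set0].
Proof.
move=> cC.
exists [set [set F : hyperspace D | F `&` C = set0]].
  by move=> _ ->; apply: finI_from1; left; exists C.
by rewrite bigcup_set1.
Qed.

Lemma vietoris_continuous (X T : topologicalType) (D : set T)
    (f : X -> hyperspace D) :
  (forall C, closed C -> open [set x | f x `&` C = set0]) ->
  (forall U, open U -> open [set x | f x `&` U !=set0]) ->
  continuous f.
Proof.
move=> fC fU; apply/continuousP => _ [B BD <-].
rewrite preimage_bigcup; apply: bigcup_open => V /BD [E EE <-].
rewrite preimage_bigcap bigcap_fset big_seq.
apply: (@big_ind _ (@open X)); [exact: openT|exact: openI|].
by move=> G /EE /set_mem [[C cC <-]|[U oU <-]]; [exact: fC|exact: fU].
Qed.

(** * Dyadic sieves and hardness *)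

Section reduction.
Context {R : realType}.

Definition dyadic (k : nat) : set R := [set t | exists m : nat, t = m%:R / 2 ^+ k].

Lemma sub_dyadic j k : (j <= k)%N -> dyadic j `<=` dyadic k.
Proof.
move=> jk _ [m ->]; exists (m * 2 ^ (k - j))%N.
rewrite natrM natrX -{2}(subnK jk) exprD.
have h i : (2 : R) ^+ i != 0 by rewrite expf_neq0.
by field; rewrite !h.
Qed.

Lemma countable_dyadic k : countable (dyadic k).
Proof.
rewrite (_ : dyadic k = range (fun m : nat => m%:R / 2 ^+ k)).
  by apply: (card_le_trans (card_image_le _ _)); exact: countableP.
by apply/seteqP; split=> [_ [m ->]|_ [m _ <-]]; exists m.
Qed.

Lemma finite_dyadic k : finite_set (dyadic k `&` `[0, 1]).
Proof.
apply: (@sub_finite_set _ _ ((fun m : nat => m%:R / 2 ^+ k : R) @` `I_(2 ^ k).+1)).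
  move=> _ [[m ->]] /=; rewrite in_itv/= => /andP[_].
  rewrite ler_pdivrMr ?exprn_gt0// mul1r -natrX ler_nat => mk.
  by exists m.
exact: finite_image.
Qed.

Lemma dyadic_approx (t e : R) : 0 <= t -> 0 < e ->
  exists k, exists2 t', dyadic k t' & 0 <= t' <= t /\ t - t' < e.
Proof.
move=> t0 e0.
have [k ke] : exists k, 1 / 2 ^+ k < e.
  exists (Num.truncn e^-1).+1; rewrite div1r invf_plt ?posrE ?exprn_gt0//.
  apply: (lt_le_trans (truncnS_gt _)).
  by rewrite -natrX ler_nat ltnW// ltn_expl.
have p0 : (0 : R) < 2 ^+ k by rewrite exprn_gt0.
exists k, ((Num.truncn (t * 2 ^+ k))%:R / 2 ^+ k).
  by exists (Num.truncn (t * 2 ^+ k)).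
have /truncn_itv/andP[h1 h2] : 0 <= t * 2 ^+ k by rewrite mulr_ge0// ltW.
split; first by rewrite ler_pdivrMr// h1 divr_ge0// ltW.
apply: le_lt_trans ke; rewrite lerBlDr -mulrDl ler_pdivlMr//.
by rewrite nat1r ltW.
Qed.

(** The points that the grid of level [k] forbids inside the [n]-th dyadic block.
    Cutting the grid down to [[0, 1]] makes it finite, hence this set open. *)
Definition coarse_gap n k : set R :=
  `]2 ^- n.+1, 2 ^- n[ `\` (dyadic k `&` `[0, 1]).

Lemma open_coarse_gap n k : open (coarse_gap n k).
Proof.
rewrite /coarse_gap setDE; apply: openI; first exact: itv_open.
apply: closed_openC; apply: compact_closed; first exact: Rhausdorff.
exact/finite_compact/finite_dyadic.
Qed.

(** Only the open blocks are filtered, so that each positive point is subject to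
    the constraints of at most one [n]. Stating the constraints one clopen set
    at a time, instead of selecting the first [k] with [W n k x], makes the
    sieve an intersection of closed sets; as the grids are nested, the coarsest
    one decides. *)
Definition dyadic_sieve (X : Type) (W : nat -> nat -> set X) (x : X) : set R :=
  [set t | `[0, 1]%classic t /\ forall n k, W n k x -> ~ coarse_gap n k t].

Lemma coarse_gap_itv n k t : coarse_gap n k t -> 2 ^- n.+1 < t < 2 ^- n.
Proof. by move=> [/=]; rewrite in_itv. Qed.

Lemma exprVn2_lt i j : 2 ^- i.+1 < (2 : R) ^- j -> (j <= i)%N.
Proof. by rewrite ltf_pV2 ?posrE ?exprn_gt0// ltr_eXn2l ?ltr1n// ltnS. Qed.

Lemma itv_exprVn2_sub n : `[2 ^- n.+1, 2 ^- n] `<=` (`[0, 1] : set R).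
Proof.
move=> t; rewrite /= !in_itv/= => /andP[h1 h2]; apply/andP; split.
  by apply: le_trans h1; rewrite invr_ge0 exprn_ge0.
by apply: le_trans h2 _; rewrite invf_le1 ?exprn_gt0// exprn_ege1// ler1n.
Qed.

Section sieve.
Context {X : topologicalType} (W : nat -> nat -> set X).

Lemma dyadic_sieve_sub x : dyadic_sieve W x `<=` `[0, 1].
Proof. by move=> t []. Qed.

Lemma not_dyadic_sieve x t : `[0, 1]%classic t -> ~ dyadic_sieve W x t ->
  exists n k, W n k x /\ coarse_gap n k t.
Proof.
move=> t01 /not_andP[//|/existsNP[n /existsNP[k /not_implyP[Wx /contrapT h]]]].
by exists n, k.
Qed.

Lemma compact_dyadic_sieve x : compact (dyadic_sieve W x).
Proof.
apply: (subclosed_compact _ (@segment_compact R 0 1)); last exact: dyadic_sieve_sub.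
rewrite (_ : dyadic_sieve W x =
  `[0, 1] `&` \bigcap_(nk in [set nk | W nk.1 nk.2 x]) ~` coarse_gap nk.1 nk.2).
  apply: closedI; first exact: itv_closed.
  by apply: closed_bigI => nk _; apply: open_closedC; exact: open_coarse_gap.
apply/seteqP; split => t [t01 h]; split => //; first by move=> [n k]; exact: h.
by move=> n k Wx; exact: (h (n, k)).
Qed.

Definition dyadic_sieve_hyperspace x : K01 R :=
  Hyperspace (@compact_dyadic_sieve x) (@dyadic_sieve_sub x).

Hypothesis W_clopen : forall n k, clopen (W n k).

(** By compactness of [[0, 1]] intersected with [C], finitely many of the open
    conditions that keep the sieve away from [C] suffice, and these persist
    near [x]. *)
Lemma dyadic_sieve_usc C : closed C -> open [set x | dyadic_sieve W x `&` C = set0].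
Proof.
move=> cC; rewrite openE => x /= fC.
have /compact_near_coveringP/(_ _ _ (fun y t => ~ dyadic_sieve W y t)) :
    compact (`[0, 1] `&` C).
  apply: (subclosed_compact _ (@segment_compact R 0 1)); last by move=> t [].
  by apply: closedI => //; exact: itv_closed.
move=> /(_ (nbhs x) _) cov; rewrite /interior.
have : \forall y \near x, `[0, 1] `&` C `<=` (fun t => ~ dyadic_sieve W y t).
  apply: cov => t [t01 Ct].
  have nt : ~ dyadic_sieve W x t.
    by move=> ft; have : (dyadic_sieve W x `&` C) t by []; rewrite fC.
  have [n [k [Wx ht]]] := not_dyadic_sieve t01 nt.
  have ot := open_nbhs_nbhs (conj (@open_coarse_gap n k) ht).
  have oW := open_nbhs_nbhs (conj (W_clopen n k).1 Wx).
  exists (coarse_gap n k, W n k) => //.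
  by move=> [s y] [/= hs Wy] [_ /(_ _ _ Wy)].
apply: filterS => y hy /=; rewrite -subset0 => t [ft Ct].
by apply: (hy t) => //; split => //; exact: dyadic_sieve_sub ft.
Qed.

Lemma gap_exists (t : R) : 0 < t <= 1 ->
  (exists k, dyadic k t) \/ exists n, `]2 ^- n.+1, 2 ^- n[%classic t.
Proof.
move=> /andP[t0 t1].
have ex : exists n, 2 ^- n.+1 < t.
  exists (Num.truncn t^-1).
  rewrite invf_plt ?posrE ?exprn_gt0//.
  apply: (lt_le_trans (truncnS_gt _)).
  by rewrite -natrX ler_nat ltnW// ltn_expl.
case: (ex_minnP ex) => n ntn nmin.
have tn : t <= 2 ^- n.
  case: n nmin {ntn} => [_|n nmin]; first by rewrite expr0 invr1.
  by rewrite leNgt; apply/negP => /nmin; rewrite ltnn.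
move: tn; rewrite le_eqVlt => /predU1P[->|tn].
  by left; exists n, 1%N; rewrite div1r.
by right; exists n; rewrite /= in_itv/= ntn tn.
Qed.

(** A non-dyadic point survives only in a block without constraints, where every
    nearby point survives too. *)
Lemma dyadic_dense_sieve x U : open U -> dyadic_sieve W x `&` U !=set0 ->
  exists K t, dyadic K t /\ (dyadic_sieve W x `&` U) t.
Proof.
move=> oU [t [[t01 ft] Ut]].
have [[K dt]|ndt] := pselect (exists K, dyadic K t); first by exists K, t.
have /andP[t0 t1] : 0 <= t <= 1 by move: t01; rewrite /= in_itv.
have tp : 0 < t <= 1.
  rewrite t1 lt_def t0 !andbT; apply/eqP => t00; apply: ndt.
  by exists 0%N, 0%N; rewrite t00 mul0r.
have [//|[n gt]] := gap_exists tp.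
have noW k : ~ W n k x.
  by move=> /ft; apply; split => // -[dt _]; apply: ndt; exists k.
have : open (`]2 ^- n.+1, 2 ^- n[ `&` U) by apply: openI => //; exact: itv_open.
rewrite openE => /(_ t (conj gt Ut)) /nbhs_ballP[e /= e0 eU].
have [k [t' dt' [/andP[t'0 t't] tt']]] := dyadic_approx t0 e0.
have [gt' Ut'] : (`]2 ^- n.+1, 2 ^- n[ `&` U) t'.
  by apply: eU; rewrite /ball/= ger0_norm// subr_ge0.
exists k, t'; split=> //; split => //; split.
  exact: (itv_exprVn2_sub (subset_itv_oo_cc gt')).
move=> m j Wx /coarse_gap_itv/andP[h1 h2].
suff mn : m = n by move: Wx; rewrite mn; exact: noW.
move: gt'; rewrite /= in_itv/= => /andP[h3 h4].
by apply/eqP; rewrite eqn_leq !exprVn2_lt//; [exact: lt_trans h4|exact: lt_trans h2].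
Qed.

(** A surviving dyadic point [t] of level [K] keeps surviving near [x]: levels
    [k >= K] allow it, and only finitely many blocks [n] reach up to [t], so that
    finitely many clopen sets decide. *)
Lemma dyadic_sieve_lsc U : open U -> open [set x | dyadic_sieve W x `&` U !=set0].
Proof.
move=> oU; rewrite openE => x /= /(dyadic_dense_sieve oU) [K [t [dt [[t01 ft] Ut]]]].
have [M tM] : exists M, forall n k, (M <= n)%N -> ~ coarse_gap n k t.
  have [t0|t0] := leP t 0.
    exists 0%N => n k _ /coarse_gap_itv/andP[h _].
    by move: (lt_le_trans h t0); rewrite ltNge invr_ge0 exprn_ge0.
  exists (Num.truncn t^-1).+1 => n k Mn /coarse_gap_itv/andP[_].
  rewrite ltNge => /negP; apply.
  rewrite invf_ple ?posrE ?exprn_gt0//.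
  apply: (le_trans (ltW (truncnS_gt _))).
  by rewrite -natrX ler_nat (leq_trans Mn)// ltnW// ltn_expl.
have near_W : \forall y \near x,
    forall i : 'I_M, forall j : 'I_K, W i j y -> W i j x.
  apply: filter_forall => i; apply: filter_forall => j.
  have [Wx|nWx] := pselect (W i j x).
    by apply: filterS (open_nbhs_nbhs (conj (W_clopen i j).1 Wx)).
  have := open_nbhs_nbhs (conj (closed_openC (W_clopen i j).2) nWx).
  by apply: filterS => y /=.
apply: filterS near_W => y WyWx; exists t; split => //; split => // n k Wy.
have [Mn|nM] := leqP M n; first exact: tM.
have [Kk|kK] := leqP K k.
  by move=> [_]; apply; split => //; exact: sub_dyadic dt.
exact: (ft n k (WyWx (Ordinal nM) (Ordinal kK) Wy)).
Qed.

Lemma continuous_dyadic_sieve : continuous dyadic_sieve_hyperspace.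
Proof.
by apply: vietoris_continuous; [exact: dyadic_sieve_usc|exact: dyadic_sieve_lsc].
Qed.

Lemma countable_dyadic_sieve x : (forall n, exists k, W n k x) ->
  countable (dyadic_sieve W x).
Proof.
move=> hW; apply: (@sub_countable _ _ _ (\bigcup_k dyadic k)); last first.
  by apply: bigcup_countable => // k _; exact: countable_dyadic.
apply: subset_card_le => t [t01 ft].
move: (t01); rewrite /= in_itv/= le_eqVlt => /andP[/predU1P[<-|t0] t1].
  by exists 0%N => //; exists 0%N; rewrite mul0r.
have [|[k dk]|[n gt]] := @gap_exists t; [by rewrite t0 t1|by exists k|].
have [k Wx] := hW n; exists k => //.
by have /not_andP[//|/contrapT[]] := ft _ _ Wx.
Qed.

Lemma gap_sub_dyadic_sieve x n : (forall k, ~ W n k x) ->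
  `[2 ^- n.+1, 2 ^- n] `<=` dyadic_sieve W x.
Proof.
move=> nW t tn; split; first exact: itv_exprVn2_sub tn.
move: tn; rewrite /= in_itv/= => /andP[h1 h2] m k Wx /coarse_gap_itv/andP[h3 h4].
suff mn : m = n by move: Wx; rewrite mn; exact: nW.
apply/eqP; rewrite eqn_leq !exprVn2_lt//; first exact: lt_le_trans h3 h2.
exact: le_lt_trans h1 h4.
Qed.

End sieve.
End reduction.

Lemma countable_enum (T : Type) (S : set T) : countable S ->
  exists f : nat -> option T, forall x, S x -> exists i, f i = Some x.
Proof.
move=> cS; have /pfcard_geP[S0|[f]] := cS.
  by exists (fun=> None) => x; rewrite S0.
exists (fun i => Some (f i)) => x Sx.
by have [i _ <-] := 'surj_f Sx; exists i.
Qed.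

(** A clopen basis need not be countable, but a separable metric space is
    Lindelof: it is enough to keep one clopen set for each ball of radius
    [1 / (j + 1)] around a point of the dense sequence that fits in a clopen
    subset of [U]. *)
Lemma open_bigcup_clopen (R : realType) (X : topologicalType) (U : set X) :
  polish R X -> clopen_basis X -> open U ->
  exists2 W : nat -> set X, (forall k, clopen (W k)) & U = \bigcup_k W k.
Proof.
move=> [[S cS dS] [d [d0 dC dT dN _]]] [B Bc bB] oU.
have [f fS] := countable_enum cS.
pose good ij (C : set X) := [/\ clopen C, C `<=` U &
  forall s, f ij.1 = Some s -> [set y | d s y < ij.2.+1%:R^-1] `<=` C].
pose W ij := if pselect (exists C, good ij C) is left e then projT1 (cid e) else set0.
have WP ij : W ij = set0 \/ good ij (W ij).
  by rewrite /W; case: pselect => [e|_]; [right; case: cid|left].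
exists (fun k => if unpickle k is Some ij then W ij else set0).
  move=> k; case: unpickle => [ij|]; last by split; [exact: open0|exact: closed0].
  by have [->|[]//] := WP ij; split; [exact: open0|exact: closed0].
apply/seteqP; split => [x Ux|x [k _]]; last first.
  by case: unpickle => // ij; have [->//|[_ + _]] := WP ij; apply.
have [C [BC Cx] CU] : filter_from [set V | B V /\ V x] id U.
  by apply: bB.2; exact: open_nbhs_nbhs.
have /dN [e e0 eC] := open_nbhs_nbhs (conj (bB.1 _ BC) Cx).
have [j je] : exists j, j.+1%:R^-1 < e / 2.
  exists (Num.truncn (e / 2)^-1).
  by rewrite invf_plt ?posrE ?divr_gt0// truncnS_gt.
have [s [ds Ss]] : [set y | d x y < j.+1%:R^-1]^° `&` S !=set0.
  apply: dS; last exact: open_interior.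
  exists x; rewrite /interior; apply/dN; by exists j.+1%:R^-1.
have {}ds := interior_subset ds.
have [i fi] := fS s Ss.
have gC : good (i, j) C.
  split; [exact: Bc|exact: CU|].
  move=> s' /=; rewrite fi => -[<-] y /= dsy; apply: eC => /=.
  apply: (le_lt_trans (dT x s y)); rewrite (splitr e).
  by apply: ltrD; [exact: lt_trans ds je|exact: lt_trans dsy je].
exists (pickle (i, j)) => //; rewrite pickleK.
have : good (i, j) (W (i, j)).
  by rewrite /W; case: pselect => [e'|ne]; [case: cid|exfalso; apply: ne; exists C].
by move=> [_ _ /(_ s fi)]; apply; rewrite /= dC.
Qed.

(** The reduction is the dyadic sieve of clopen sets that exhaust the complements
    of the closed pieces. *)
Lemma hard_of_countable_interval (R : realType) (B : set (K01 R)) :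
  (forall A : K01 R, countable A -> ~ B A) ->
  (forall (A : K01 R) a b, a < b -> `[a, b] `<=` (A : set R) -> B A) ->
  hard R Sigma02 B.
Proof.
move=> Bcount Bitv X pX cX A [F cF ->].
have /choice[W hW] n : exists W : nat -> set X,
    (forall k, clopen (W k)) /\ ~` F n = \bigcup_k W k.
  have [W W1 W2] := open_bigcup_clopen pX cX (closed_openC (cF n)).
  by exists W.
exists (dyadic_sieve_hyperspace W).
  by apply: continuous_dyadic_sieve => n k; exact: (hW n).1.
move=> x; split => [[n _ Fx]|Bx].
  apply: (Bitv _ (2 ^- n.+1) (2 ^- n)).
    by rewrite ltf_pV2 ?posrE ?exprn_gt0// ltr_eXn2l ?ltr1n.
  apply: gap_sub_dyadic_sieve => k Wx.
  by have : (~` F n) x by rewrite (hW n).2; exists k.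
apply: contrapT => nFx; apply: Bcount Bx; apply: countable_dyadic_sieve => n.
have : (~` F n) x by move=> Fx; apply: nFx; exists n.
by rewrite (hW n).2 => -[k _ Wx]; exists k.
Qed.

Lemma Fsigma_bigcup2 (T : topologicalType) (F : nat -> nat -> set T) :
  (forall i j, closed (F i j)) -> Fsigma (\bigcup_i \bigcup_j F i j).
Proof.
move=> cF; exists (fun k => if unpickle k is Some ij then F ij.1 ij.2 else set0).
  by move=> k; case: unpickle => [[i j]|]; [exact: cF|exact: closed0].
apply/seteqP; split => [x [i _ [j _ Fx]]|x [k _]].
  by exists (pickle (i, j)) => //; rewrite pickleK.
by case: unpickle => // -[i j] Fx; exists i => //; exists j.
Qed.

(** * Hausdorff dimension *)

Section hausdorff.
Context {R : realType}.
Implicit Types (A U : set R) (s e : R) (a u : nat -> R).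

(** A lower bound for the Hausdorff content. The covers are parametrized by the
    costs [u i] (the [s]-th powers of the radii) and the bound is put on finite
    partial sums, so that no extended real number is involved. *)
Definition cover_resistant s e A := forall a u : nat -> R,
  (forall i, 0 < u i) -> (forall n, \sum_(i < n) u i <= e) ->
  ~ A `<=` \bigcup_i ball (a i) (u i `^ s^-1).

Lemma diam_ub U x y : U x -> U y -> (`|x - y|%:E <= diam U)%E.
Proof. by move=> Ux Uy; apply: ereal_sup_ubound; exists x, y. Qed.

Lemma diam_le U e : (forall x y, U x -> U y -> `|x - y| <= e) -> (diam U <= e%:E)%E.
Proof.
move=> h; apply: ge_ereal_sup => _ [x [y [Ux Uy ->]]].
by rewrite lee_fin h.
Qed.

Lemma diam_ge0 U x : U x -> (0 <= diam U)%E.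
Proof. by move=> Ux; apply: le_trans (diam_ub Ux Ux); rewrite lee_fin. Qed.

Lemma diam_pow_ge0 s U : (0 <= diam_pow s U)%E.
Proof. by rewrite /diam_pow; case: ifP => // _; exact: poweR_ge0. Qed.

Lemma sub_ball_diam_pow s U w v : 0 < s -> (diam U < +oo)%E ->
  diam_pow s U = w%:E -> w < v -> exists c, U `<=` ball c (v `^ s^-1).
Proof.
move=> s0 Uoo dU wv.
have [->|/set0P[c Uc]] := eqVneq U set0; first by exists 0.
exists c => x Ux; rewrite /ball/= -lte_fin.
apply: le_lt_trans (diam_ub Uc Ux) _.
have d0 := diam_ge0 Uc.
have Un0 : U != set0 by apply/set0P; exists c.
move: dU; rewrite /diam_pow (negbTE Un0).
case: (diam U) Uoo d0 => // r _; rewrite lee_fin => r0 -[rw].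
rewrite lte_fin -{1}(powRr1 r0) -(mulfV (negbT (gt_eqF s0))) powRrM rw.
have w0 : 0 <= w by rewrite -rw powR_ge0.
by apply: gt0_ltr_powR => //; rewrite ?invr_gt0// nnegrE// (le_trans w0 (ltW wv)).
Qed.

Lemma sum_halves e n : \sum_(i < n) (e / 2 ^+ i.+1) = e - e / 2 ^+ n.
Proof.
elim: n => [|n ih]; first by rewrite big_ord0 expr0 divr1 subrr.
have h : (2 : R) ^+ n != 0 by rewrite expf_neq0.
by rewrite big_ord_recr/= ih exprS; field.
Qed.

Lemma halves_gt0 e n : 0 < e -> 0 < e / 2 ^+ n.
Proof. by move=> e0; rewrite divr_gt0// exprn_gt0. Qed.

Lemma sum_halves_le e n : 0 < e -> \sum_(i < n) (e / 2 ^+ i.+1) <= e.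
Proof. by move=> e0; rewrite sum_halves gerBl ltW// halves_gt0. Qed.

(** A cover by arbitrary sets is turned into a cover by open balls at the
    expense of [e / 2] in the total cost, distributed geometrically. *)
Lemma hausdorff_measure_gt0 s e A : 0 < s -> 0 < e -> cover_resistant s e A ->
  (0 < hausdorff_measure s A)%E.
Proof.
move=> s0 e0 Ae.
apply: (@lt_le_trans _ _ (hausdorff_premeasure s 1 A)); last first.
  by apply: ereal_sup_ubound; exists 1 => /=.
apply: (@lt_le_trans _ _ (e / 2)%:E); first by rewrite lte_fin divr_gt0.
apply: le_ereal_inf_tmp => _ [U [AU U1] <-].
rewrite leNgt; apply/negP => sumU.
have fin i : diam_pow s (U i) \is a fin_num.
  rewrite ge0_fin_numE ?diam_pow_ge0// /diam_pow; case: ifP => // _.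
  by apply: poweR_lty; apply: le_lt_trans (U1 i) _; rewrite ltry.
pose u i := fine (diam_pow s (U i)) + e / 2 / 2 ^+ i.+1.
have e20 : 0 < e / 2 by rewrite divr_gt0.
have /choice[a aU] i : exists c, U i `<=` ball c (u i `^ s^-1).
  apply: (@sub_ball_diam_pow _ _ (fine (diam_pow s (U i)))) => //.
  - by apply: le_lt_trans (U1 i) _; rewrite ltry.
  - by rewrite fineK.
  - by rewrite ltrDl halves_gt0.
apply: (Ae a u).
- by move=> i; rewrite ltr_wpDl ?halves_gt0// fine_ge0// diam_pow_ge0.
- move=> n; rewrite /u big_split/= [leRHS]splitr lerD//; last exact: sum_halves_le.
  rewrite -lee_fin -sumEFin.
  under eq_bigr do rewrite fineK//.
  apply: le_trans (ltW sumU); rewrite -(big_mkord xpredT (fun i => diam_pow s (U i))).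
  by apply: nneseries_lim_ge => i _ _; exact: diam_pow_ge0.
- by move=> x /AU [i _ Ux]; exists i => //; exact: aU.
Qed.

Lemma diam_ball (c r : R) : 0 <= r -> (diam (ball c r) <= (r *+ 2)%:E)%E.
Proof.
move=> r0; apply: diam_le => x y; rewrite /ball/= => cx cy.
rewrite mulr2n (_ : x - y = (c - y) - (c - x)); last by ring.
by apply: le_trans (ler_normB _ _) _; rewrite lerD// ltW.
Qed.

(** A cheap cover consists of small sets only. So if the total cost could be made
    arbitrarily small, the scale [delta] of the Hausdorff premeasure would be no
    constraint, nor would raising the exponent from [s'] to [s] increase the
    cost, up to the factor [2^s] that compares diameters with radii. *)
Lemma cover_resistant_exists s s' A : 0 < s' <= s -> (0 < hausdorff_measure s A)%E ->
  exists2 e, 0 < e & cover_resistant s' e A.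
Proof.
move=> /andP[s'0 s's] As; apply: contrapT => /forall2NP nA.
have s0 : 0 < s by exact: lt_le_trans s's.
have {}nA e : 0 < e -> exists a u, [/\ forall i, 0 < u i,
    forall n, \sum_(i < n) u i <= e & A `<=` \bigcup_i ball (a i) (u i `^ s'^-1)].
  move=> e0; have [//|/existsNP[a /existsNP[u]]] := nA e.
  by move=> /not_implyP[u0 /not_implyP[ue /contrapT Au]]; exists a, u.
move: As; rewrite ltNge => /negP; apply.
apply: ge_ereal_sup => _ [delta /= d0 <-].
apply/lee_addgt0Pr => eta eta0; rewrite add0e.
have p2 : 0 < 2 `^ s :> R by rewrite powR_gt0.
(* radii at most 1, diameters at most [delta], total cost at most [eta] *)
pose e := Num.min 1 (Num.min ((delta / 2) `^ s') (eta / 2 `^ s)).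
have e0 : 0 < e by rewrite !lt_min ltr01 powR_gt0 ?divr_gt0.
have [a [u [u0 ue Au]]] := nA e e0.
have uie i : u i <= e.
  apply: le_trans (ue i.+1); rewrite big_ord_recr/= lerDr.
  by apply: sumr_ge0 => j _; exact: ltW.
pose r i := u i `^ s'^-1.
have r0 i : 0 < r i by rewrite powR_gt0.
have rs' i : r i `^ s' = u i.
  by rewrite -powRrM mulVf ?gt_eqF// powRr1// ltW.
have rd i : r i *+ 2 <= delta.
  rewrite -mulr_natr -ler_pdivlMr//.
  have : u i <= (delta / 2) `^ s'.
    by apply: le_trans (uie i) _; rewrite !ge_min lexx !orbT.
  rewrite -rs'; rewrite !leNgt; apply: contra => h.
  by apply: gt0_ltr_powR => //; rewrite nnegrE ltW// divr_gt0.
have r1 i : r i <= 1.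
  have -> : 1 = 1 `^ s'^-1 :> R by rewrite powR1.
  apply: ge0_ler_powR; rewrite ?nnegrE ?invr_ge0 ?ler01 ?(ltW s'0) ?(ltW (u0 i))//.
  by apply: le_trans (uie i) _; rewrite ge_min lexx.
apply: (@le_trans _ _ (\sum_(0 <= i <oo) diam_pow s (ball (a i) (r i)))%E).
  apply: ereal_inf_lbound; exists (fun i => ball (a i) (r i)) => //; split=> // i.
  by apply: le_trans (diam_ball _ (ltW (r0 i))) _; rewrite lee_fin.
have dp i : (diam_pow s (ball (a i) (r i)) <= (2 `^ s * u i)%:E)%E.
  rewrite /diam_pow; case: ifPn => [_|/set0P[x xb]].
    by rewrite lee_fin mulr_ge0 ?ltW.
  have := diam_ball (a i) (ltW (r0 i)); have := diam_ge0 xb.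
  case: (diam _) => // d; rewrite !lee_fin => d0' d2.
  apply: (@le_trans _ _ ((2 * r i) `^ s)).
    apply: ge0_ler_powR; rewrite ?nnegrE ?(ltW s0) ?mulr_ge0 ?(ltW (r0 i))//.
    by rewrite mulr_natl.
  have ri0 := ltW (r0 i); rewrite powRM// ler_pM2l// -rs'.
  by apply: ger_powR => //; rewrite r0 r1.
apply: lime_le; first by apply: is_cvg_nneseries => i _ _; exact: diam_pow_ge0.
apply: nearW => n; rewrite big_mkord.
apply: (@le_trans _ _ (\sum_(i < n) (2 `^ s * u i)%:E)%E); first exact: lee_sum.
rewrite sumEFin lee_fin -mulr_sumr mulrC -ler_pdivlMr//.
by apply: le_trans (ue n) _; rewrite !ge_min lexx !orbT.
Qed.

Lemma hausdorff_dim_gtP (p : R) A : 0 <= p ->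
  (p%:E < hausdorff_dim A)%E <->
  exists s e, [/\ p < s, 0 < e & cover_resistant s e A].
Proof.
move=> p0; split.
  move=> /ereal_sup_gt[_ [->|[s [s0 As] <-]]]; first by rewrite lte_fin ltNge p0.
  rewrite lte_fin => ps.
  have [|e e0 Ae] := @cover_resistant_exists s s A _ As.
    by rewrite lexx andbT (le_lt_trans p0 ps).
  by exists s, e.
move=> [s [e [ps e0 Ae]]].
have s0 : 0 < s by exact: le_lt_trans ps.
apply: (@lt_le_trans _ _ s%:E); first by rewrite lte_fin.
apply: ereal_sup_ubound; right; exists s => //; split; first exact: ltW.
exact: hausdorff_measure_gt0 e0 Ae.
Qed.

(** Lowering the exponent makes it possible to use countably many exponents. *)
Lemma cover_resistant_le s s' e A : 0 < s' <= s -> 0 < e -> cover_resistant s e A ->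
  exists2 e', 0 < e' & cover_resistant s' e' A.
Proof.
move=> s's e0 Ae; apply: (cover_resistant_exists s's).
apply: hausdorff_measure_gt0 e0 Ae.
by move: s's => /andP[/lt_le_trans]; exact.
Qed.

Lemma cover_resistant_anti s e e' A : e' <= e ->
  cover_resistant s e A -> cover_resistant s e' A.
Proof. by move=> ee' Ae a u u0 ue'; apply: Ae => // n; exact: le_trans ee'. Qed.

(** Each cover by balls excludes the compact sets that it covers, which form a
    subbasic open set. *)
Lemma closed_cover_resistant s e : closed [set A : K01 R | cover_resistant s e A].
Proof.
rewrite (_ : [set A : K01 R | cover_resistant s e A] =
  \bigcap_(au in [set au : (nat -> R) * (nat -> R) |
     (forall i, 0 < au.2 i) /\ (forall n, \sum_(i < n) au.2 i <= e)])
    ~` [set A : K01 R |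
       A `&` ~` (\bigcup_i ball (au.1 i) (au.2 i `^ s^-1)) = set0]).
  apply: closed_bigI => -[a u] _; apply: open_closedC; apply: open_vietoris_miss.
  by apply: open_closedC; apply: bigcup_open => i _; exact: ball_open.
apply/seteqP; split => A /= hA.
  move=> [a u] [u0 ue] /= /disjoints_subset; rewrite setCK; exact: hA.
move=> a u u0 ue /subsets_disjoint; apply: (hA (a, u)).
by split.
Qed.

Lemma Sigma02_hausdorff_dim (p : R) : 0 <= p ->
  Sigma02 [set A : K01 R | (p%:E < hausdorff_dim A)%E].
Proof.
move=> p0.
rewrite (_ : mkset _ = \bigcup_i \bigcup_j
    [set A : K01 R | cover_resistant (p + i.+1%:R^-1) j.+1%:R^-1 A]).
  by apply: Fsigma_bigcup2 => i j; exact: closed_cover_resistant.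
have small e : 0 < e -> exists j : nat, j.+1%:R^-1 < e.
  by move=> e0; exists (Num.truncn e^-1); rewrite invf_plt ?posrE// truncnS_gt.
apply/seteqP; split => A /=.
  move=> /(hausdorff_dim_gtP _ p0) [s [e [ps e0 Ae]]].
  have [i si] : exists i : nat, i.+1%:R^-1 < s - p by apply: small; rewrite subr_gt0.
  have s's : 0 < p + i.+1%:R^-1 <= s by rewrite ltr_wpDl//= -lerBrDl ltW.
  have [e' e'0 Ae'] := cover_resistant_le s's e0 Ae.
  have [j je] := small _ e'0.
  by exists i => //; exists j => //; exact: cover_resistant_anti (ltW je) Ae'.
move=> [i _ [j _ Aij]]; apply/(hausdorff_dim_gtP _ p0).
by exists (p + i.+1%:R^-1), j.+1%:R^-1; rewrite ltrDl.
Qed.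

Lemma countable_hausdorff_dim (p : R) A : 0 <= p -> countable A ->
  ~ (p%:E < hausdorff_dim A)%E.
Proof.
move=> p0 cA /(hausdorff_dim_gtP _ p0) [s [e [ps e0 Ae]]].
have [f fA] := countable_enum cA.
apply: (Ae (fun i => odflt 0 (f i)) (fun i => e / 2 ^+ i.+1)).
- by move=> i; exact: halves_gt0.
- by move=> n; exact: sum_halves_le.
- move=> x /fA [i fi]; exists i => //; rewrite fi /=; apply: ballxx.
  by rewrite powR_gt0// halves_gt0.
Qed.

(** By subadditivity of Lebesgue measure, covers of [[a, b]] by balls of total
    radius at most [(b - a) / 4] do not exist. *)
Lemma interval_hausdorff_dim (p : R) A (a b : R) : 0 <= p < 1 -> a < b ->
  `[a, b] `<=` A -> (p%:E < hausdorff_dim A)%E.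
Proof.
move=> /andP[p0 p1] ab abA; apply/(hausdorff_dim_gtP _ p0).
have ab0 : 0 < (b - a) / 4 by rewrite divr_gt0// subr_gt0.
exists 1, ((b - a) / 4); split => // c u u0 ue Acov.
have cov : `[a, b]%classic `<=` \bigcup_i ball (c i) (u i).
  move=> x /abA /Acov [i _]; rewrite invr1 powRr1 ?ltW//.
  by exists i.
have mball i : measurable (ball (c i) (u i)).
  by apply: open_measurable; exact: ball_open.
have : (lebesgue_measure `[a, b]%classic <=
    \sum_(0 <= i <oo) lebesgue_measure (ball (c i) (u i)))%E.
  by apply: measure_sigma_subadditive => //; exact: measurable_itv.
rewrite lebesgue_measure_itv/= lte_fin ab leNgt => /negP; apply.
apply: (@le_lt_trans _ _ ((b - a) / 2)%:E); last first.
  by rewrite -EFinD lte_fin; lra.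
apply: lime_le; first by apply: is_cvg_nneseries.
apply: nearW => n; rewrite big_mkord.
under eq_bigr do rewrite lebesgue_measure_ball ?ltW// -mulr_natr.
rewrite sumEFin lee_fin -mulr_suml; have := ue n; lra.
Qed.
End hausdorff.

(** * Quantile functions *)

Section quantile.
Context {R : realType}.
Local Notation leb := (@lebesgue_measure R).
Local Notation mR := (measurableTypeR R).

Definition uniform01 : set mR -> \bar R := mrestr leb (measurable_itv `]0, 1[).

HB.instance Definition _ := Measure.on uniform01.

Lemma uniform01_setT : uniform01 [set: mR] = 1%E.
Proof.
rewrite /uniform01 /mrestr setTI lebesgue_measure_itv/= lte_fin ltr01.
by rewrite oppr0 adde0.
Qed.

HB.instance Definition _ :=
  Measure_isProbability.Build _ _ _ uniform01 uniform01_setT.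

Lemma monotone_measurable (q : R -> R) : {homo q : x y / x <= y} ->
  measurable_fun [set: mR] (q : mR -> mR).
Proof. by move=> qm; apply: nondecreasing_measurable. Qed.

Definition monotone_mfun (q : R -> R) (qm : {homo q : x y / x <= y}) :
  {mfun mR >-> mR} :=
  @mfun_Sub _ _ mR mR q (mem_set (monotone_measurable qm)).

Definition quantile_law (q : R -> R) (qm : {homo q : x y / x <= y}) :
    probability mR R :=
  distribution uniform01 (monotone_mfun qm).

Lemma quantile_lawE q (qm : {homo q : x y / x <= y}) B :
  quantile_law qm B = leb (q @^-1` B `&` `]0, 1[).
Proof. by []. Qed.

(** The integral of [g] against the law of which [q] is the quantile function. *)
Definition quantile_mean (q g : R -> R) : R := \int[leb]_(t in `]0, 1[) g (q t).

Lemma bounded_integrable (m : {measure set mR -> \bar R}) (D : set R)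
    (f : R -> R) (K : R) :
  measurable (D : set mR) -> (m D < +oo)%E ->
  measurable_fun [set: mR] f -> (forall t, `|f t| <= K) ->
  m.-integrable D (EFin \o f).
Proof.
move=> mD Doo mf fK; apply: measurable_bounded_integrable => //.
  exact: measurable_funTS.
exists K; split; first exact: num_real.
by move=> x Kx t _; apply: le_trans (fK t) (ltW Kx).
Qed.

Lemma lebesgue_bounded_itv (b b' : bool) (x y : R) :
  (leb [set` Interval (BSide b x) (BSide b' y)] < +oo)%E.
Proof. by rewrite lebesgue_measure_itv/=; case: ifP => _; rewrite ltry. Qed.

Lemma Rintegral_quantile_law q (qm : {homo q : x y / x <= y}) (g : R -> R) (K : R) :
  measurable_fun [set: mR] g -> (forall x, `|g x| <= K) ->
  \int[quantile_law qm]_x g x = quantile_mean q g.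
Proof.
move=> mg gK; rewrite /Rintegral /quantile_mean /Rintegral; congr fine.
have mgq : measurable_fun [set: mR] (g \o q).
  by apply: measurableT_comp => //; exact: monotone_measurable.
have mgE : measurable_fun [set: mR] (EFin \o g) by apply/measurable_EFinP.
have ig : (uniform01 : {measure set mR -> \bar R}).-integrable [set: mR]
    (EFin \o (g \o q)).
  apply: (bounded_integrable _ _ mgq) => //; first by rewrite [ltLHS]uniform01_setT ltry.
  by move=> t; exact: gK.
rewrite integral_distribution//.
rewrite (@negligible_integral _ _ _ uniform01 _ (~` `]0, 1[))//; last 2 first.
- by apply: measurableC; exact: measurable_itv.
- by transitivity (leb (~` `]0, 1[ `&` `]0, 1[)) => //; rewrite setICl measure0.
rewrite setTD setCK; apply: eq_measure_integral => B mB B01.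
by transitivity (leb (B `&` `]0, 1[)) => //; rewrite setIidl.
Qed.

(** On each cell [g] varies by at most [L] times the increment of [q], and these
    increments add up to at most 1; so the error is uniform in [q]. *)
Lemma quantile_mean_riemann (q g : R -> R) (L K : R) N :
  {homo q : x y / x <= y} -> (forall t, 0 <= q t <= 1) ->
  measurable_fun [set: mR] g -> (forall x, `|g x| <= K) ->
  0 <= L -> (forall x y, `|g x - g y| <= L * `|x - y|) ->
  `|quantile_mean q g - N.+1%:R^-1 * \sum_(i < N.+1) g (q (i%:R / N.+1%:R))|
    <= L / N.+1%:R.
Proof.
move=> qm q01 mg gK L0 gL.
have mgq : measurable_fun [set: mR] (g \o q).
  by apply: measurableT_comp => //; exact: monotone_measurable.
have ib (b b' : bool) (y z : R) :
    leb.-integrable [set` Interval (BSide b y) (BSide b' z)] (EFin \o (g \o q)).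
  apply: (@bounded_integrable leb _ _ K);
    [exact: measurable_itv|exact: lebesgue_bounded_itv|exact: mgq|
     by move=> t; exact: gK].
pose x n : R := n%:R / N.+1%:R.
have xS n : x n.+1 - x n = N.+1%:R^-1 by rewrite /x -mulrBl -natrB// subSnn mul1r.
have xlt n : x n < x n.+1 by rewrite -subr_gt0 xS.
have step n :
  `|\int[leb]_(t in `]0, x n]) g (q t) - N.+1%:R^-1 * \sum_(i < n) g (q (x i))|
    <= L / N.+1%:R * (q (x n) - q 0).
  elim: n => [|n ih].
    by rewrite big_ord0 /x mul0r mulr0 subr0 set_itvoc0 Rintegral_set0 normr0 subrr mulr0.
  have x0 : 0 <= x n by rewrite divr_ge0.
  have U : `]0, x n.+1]%classic = `]0, x n] `|` `]x n, x n.+1].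
    by apply: itv_bndbnd_setU; rewrite bnd_simp// ltW.
  have ibU : leb.-integrable (`]0, x n] `|` `]x n, x n.+1]) (EFin \o (g \o q)).
    by rewrite -U.
  rewrite U Rintegral_setU//; last first.
    apply/disj_setPS => t []/=; rewrite !in_itv/= => /andP[_ h] /andP[h' _].
    by move: (lt_le_trans h' h); rewrite ltxx.
  have cell : `|\int[leb]_(t in `]x n, x n.+1]) g (q t) - N.+1%:R^-1 * g (q (x n))|
      <= L / N.+1%:R * (q (x n.+1) - q (x n)).
    have lcell : fine (leb `]x n, x n.+1]) = N.+1%:R^-1.
      by rewrite lebesgue_measure_itv/= lte_fin xlt -EFinB/= xS.
    have icst c : leb.-integrable `]x n, x n.+1] (EFin \o (fun=> c)).
      apply: (@bounded_integrable leb _ _ `|c|) => //.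
      exact: lebesgue_bounded_itv.
    have mgc : measurable_fun [set: mR] (fun t => g (q t) - g (q (x n))).
      by apply: measurable_funB.
    have gcK t : `|g (q t) - g (q (x n))| <= K + K.
      by apply: le_trans (ler_normB _ _) _; rewrite lerD.
    rewrite -lcell mulrC -Rintegral_cst// -RintegralB//.
    apply: le_trans (le_normr_Rintegral _ _) _ => //.
      apply: (bounded_integrable _ _ mgc gcK) => //; exact: lebesgue_bounded_itv.
    rewrite mulrAC -Rintegral_cst//; apply: le_Rintegral => //.
      apply: (@bounded_integrable leb _ _ (K + K)) => //.
      + exact: lebesgue_bounded_itv.
      + exact: measurableT_comp.
      + by move=> t; rewrite normr_id.
    move=> t /=; rewrite in_itv/= => /andP[h1 h2].
    apply: le_trans (gL _ _) _; apply: ler_wpM2l => //.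
    by rewrite ger0_norm ?subr_ge0 ?qm ?(ltW h1)// lerD2r qm.
  rewrite big_ord_recr/= mulrDr opprD addrACA.
  apply: le_trans (ler_normD _ _) _.
  apply: le_trans (lerD ih cell) _.
  by rewrite -mulrDr addrC addrA subrK.
have xN : x N.+1 = 1 by rewrite /x divff.
rewrite /quantile_mean Rintegral_itv_bndo_bndc//.
have := step N.+1; rewrite xN => /le_trans; apply.
apply: ler_piMr; first by rewrite divr_ge0.
have /andP[_ h1] := q01 1; have /andP[h0 _] := q01 0; lra.
Qed.

Section law_quantile.
Variable mu : probability mR R.

Let idmR : mR -> R := idfun.

#[local] HB.instance Definition _ :=
  @isMeasurableFun.Build _ _ _ _ idmR (@measurable_id _ _ setT).

Let F : R -> \bar R := cdf (idmR : {RV mu >-> R}).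

Let FE x : F x = mu `]-oo, x]%classic.
Proof. by []. Qed.

Lemma cdf_gt t : t < 1 -> exists x, (t%:E < F x)%E.
Proof.
move=> t1.
have : \forall x \near +oo%R, (t%:E < F x)%E.
  apply: (@cvg_cdfy1 _ _ _ mu (idmR : {RV mu >-> R}) [set y | (t%:E < y)%E]).
  apply: open_nbhs_nbhs; split.
    exact: open_ereal_gt_ereal.
  by rewrite /= lte_fin.
case=> M [_ hM]; exists (M + 1); apply: hM; rewrite ltrDl//.
Qed.

Lemma cdf_lt t : 0 < t -> exists x, (F x < t%:E)%E.
Proof.
move=> t0.
have : \forall x \near -oo%R, (F x < t%:E)%E.
  apply: (@cvg_cdfNy0 _ _ _ mu (idmR : {RV mu >-> R}) [set y | (y < t%:E)%E]).
  apply: open_nbhs_nbhs; split.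
    exact: open_ereal_lt_ereal.
  by rewrite /= lte_fin.
by case=> M [_ hM]; exists (M - 1); apply: hM; rewrite gtrDl.
Qed.

Lemma cdf_lt_right t x : (F x < t%:E)%E -> exists2 y, x < y & (F y < t%:E)%E.
Proof.
move=> Fx.
have : \forall y \near x^'+, (F y < t%:E)%E.
  apply: (@cdf_right_continuous _ _ _ mu (idmR : {RV mu >-> R}) x [set y | (y < t%:E)%E]).
  apply: open_nbhs_nbhs; split.
    exact: open_ereal_lt_ereal.
  by [].
move=> [e /= e0 he]; exists (x + e / 2); first by rewrite ltrDl divr_gt0.
apply: he; last by rewrite ltrDl divr_gt0.
by rewrite /= opprD addNKr normrN gtr0_norm ?divr_gt0// gtr_pMr// invf_lt1 ?ltr1n.
Qed.

Definition quantile t : R := inf [set x | (t%:E <= F x)%E].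

Lemma quantile_has_inf t : 0 < t < 1 -> has_inf [set x | (t%:E <= F x)%E].
Proof.
move=> /andP[t0 t1]; split.
  by have [x /ltW] := cdf_gt t1; exists x.
have [x Fx] := cdf_lt t0; exists x => y /= ty.
rewrite leNgt; apply/negP => yx.
by have := le_lt_trans (le_trans ty (cdf_nondecreasing _ (ltW yx))) Fx; rewrite ltxx.
Qed.

(** The Galois connection between quantiles and distribution functions; it rests
    on right continuity. *)
Lemma quantile_gtP t x : 0 < t < 1 -> (x < quantile t) = (F x < t%:E)%E.
Proof.
move=> t01; have [S0 Sb] := quantile_has_inf t01.
apply/idP/idP => [xq|/cdf_lt_right[y xy Fy]].
  rewrite ltNge; apply/negP => tF.
  by have := lt_le_trans xq (ge_inf Sb tF); rewrite ltxx.
apply: lt_le_trans xy _; apply: lb_le_inf => // z /= tz.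
rewrite leNgt; apply/negP => zy.
by have := le_lt_trans (le_trans tz (cdf_nondecreasing _ (ltW zy))) Fy; rewrite ltxx.
Qed.

Lemma quantile_homo s t : 0 < s < 1 -> 0 < t < 1 -> s <= t -> quantile s <= quantile t.
Proof.
move=> s01 t01 st; rewrite leNgt; apply/negP => ts.
have : (F (quantile t) < t%:E)%E.
  by apply: (lt_le_trans _ (_ : s%:E <= _)%E) => //; rewrite -quantile_gtP.
by rewrite -quantile_gtP// ltxx.
Qed.

Lemma quantile_support t : 0 < t < 1 -> measure_support mu (quantile t).
Proof.
move=> t01 U oU Ut.
have /nbhs_ballP[e /= e0 eU] : nbhs (quantile t) U by exact: open_nbhs_nbhs.
have Fl : (F (quantile t - e / 2) < t%:E)%E.
  by rewrite -quantile_gtP// gtrDl oppr_lt0 divr_gt0.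
have Fr : (t%:E <= F (quantile t + e / 2))%E.
  rewrite leNgt -quantile_gtP// -leNgt lerDl divr_ge0// ltW//.
pose I : set R := `]quantile t - e / 2, quantile t + e / 2]%classic.
have le_muU : (mu I <= mu U)%E.
  apply: le_measure; rewrite ?inE; [exact: measurable_itv|exact: open_measurable|].
  move=> x; rewrite /I /= in_itv/= => /andP[h1 h2]; apply: eU.
  by rewrite /ball/= ltr_norml; apply/andP; split; lra.
apply: lt_le_trans le_muU.
rewrite lt_def measure_ge0 andbT; apply/eqP => m0.
have := lt_le_trans Fl Fr.
rewrite ltNge => /negP; apply.
rewrite !FE.
rewrite (_ : `]-oo, quantile t + e / 2]%classic =
  `]-oo, quantile t - e / 2] `|` I); last first.
  by apply: itv_bndbnd_setU; rewrite ?bnd_simp//; lra.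
have -> : mu (`]-oo, (quantile t - e / 2)%R] `|` I) =
    (mu `]-oo, (quantile t - e / 2)%R]%classic + mu I)%E.
  apply: measureU; [exact: measurable_itv|exact: measurable_itv|].
  rewrite -subset0 => z []; rewrite /I /= !in_itv/= => h /andP[h' _].
  by move: (lt_le_trans h' h); rewrite ltxx.
by rewrite m0 adde0.
Qed.

(** The constant values outside the open unit interval make the function monotone
    on the whole line, without changing its law. *)
Definition clamped_quantile t : R :=
  if t <= 0 then 0 else if 1 <= t then 1 else quantile t.

Hypothesis mu01 : measure_support mu `<=` `[0, 1].

Lemma clamped_quantileE t : 0 < t < 1 -> clamped_quantile t = quantile t.
Proof. by move=> /andP[t0 t1]; rewrite /clamped_quantile leNgt t0/= leNgt t1. Qed.

Lemma clamped_quantile01 t : 0 <= clamped_quantile t <= 1.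
Proof.
rewrite /clamped_quantile; have [_|t0] := leP t 0; first by rewrite lexx ler01.
have [_|t1] := leP 1 t; first by rewrite ler01 lexx.
by have /mu01 := quantile_support (introT andP (conj t0 t1)); rewrite /= in_itv.
Qed.

Lemma clamped_quantile_homo : {homo clamped_quantile : s t / s <= t}.
Proof.
move=> s t st.
have [s0|s0] := leP s 0.
  by rewrite [leLHS]/clamped_quantile s0; have /andP[] := clamped_quantile01 t.
have [t1|t1] := leP 1 t.
  rewrite [leRHS]/clamped_quantile t1 (leNgt t) (lt_le_trans ltr01 t1)/=.
  by have /andP[] := clamped_quantile01 s.
rewrite !clamped_quantileE; [|by rewrite (lt_le_trans s0 st) t1
  |by rewrite s0 (le_lt_trans st t1)].
by apply: quantile_homo => //; rewrite ?s0 ?t1 ?(lt_le_trans s0 st) ?(le_lt_trans st t1).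
Qed.

(** Both laws give [1 - F x] to the half-line above [x], since [q t > x] iff
    [t > F x]. *)
Lemma quantile_law_clamped B : measurable (B : set mR) ->
  mu B = quantile_law clamped_quantile_homo B.
Proof.
move=> mB; refine (@measure_unique _ R mR (@RGenOInfty.G R)
  (fun n => `]- n%:R, +oo[%classic) _ _ _ _ mu
  (quantile_law clamped_quantile_homo) _ _ B mB).
- exact: (RGenOInfty.measurableE R).
- move=> _ _ [x ->] [y ->]; exists (Num.max x y).
  by apply/seteqP; split => z; rewrite /= !in_itv/= !andbT gt_max => /andP.
- by move=> n; exists (- n%:R).
- apply/seteqP; split => // x _; exists (Num.truncn (- x)).+1 => //=.
  rewrite in_itv/= andbT ltrNl.
  have [x0|x0] := leP 0 (- x); first exact: truncnS_gt.
  by apply: lt_le_trans x0 _.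
- move=> _ [x ->].
  have muE : mu `]x, +oo[%classic = (1 - F x)%E.
    by rewrite FE -setCitvl probability_setC.
  apply: (etrans muE).
  transitivity (leb (clamped_quantile @^-1` `]x, +oo[ `&` `]0, 1[)); last by [].
  have Ffin : F x = (fine (F x))%:E by rewrite fineK// FE fin_num_measure.
  have Fx0 : 0 <= fine (F x) by rewrite fine_ge0.
  have Fx1 : fine (F x) <= 1 by rewrite -lee_fin -Ffin; exact: probability_le1.
  rewrite (_ : _ `&` _ = `]fine (F x), 1[%classic); last first.
    apply/seteqP; split => t; rewrite /= !in_itv/= ?andbT.
      move=> [+ t01]; rewrite clamped_quantileE// quantile_gtP//.
      by rewrite Ffin lte_fin => -> /=; case/andP: t01.
    move=> /andP[Ft t1].
    have t01 : 0 < t < 1 by rewrite t1 (le_lt_trans Fx0 Ft).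
    by split=> //; rewrite clamped_quantileE// quantile_gtP// Ffin lte_fin.
  rewrite lebesgue_measure_itv/= lte_fin {1}Ffin -!EFinD.
  by case: ltP => // F1; congr EFin; lra.
- by move=> n; rewrite (le_lt_trans (probability_le1 _ _)) ?ltry//; exact: measurable_itv.
Qed.

End law_quantile.
End quantile.

(** * Measures with polynomial Fourier decay *)

Lemma fmap_ultra (T S : Type) (f : T -> S) (U : set_system T) :
  UltraFilter U -> UltraFilter (f @ U).
Proof.
move=> UU; apply: Build_UltraFilter => G GG UG.
apply/seteqP; split => // B GB.
have [//|UB] := in_ultra_setVsetC (f @^-1` B) UU.
by have [x []] := @filter_ex _ G _ _ (filterI GB (UG (~` B) UB)).
Qed.

Section fourier.
Context {R : realType}.
Local Notation leb := (@lebesgue_measure R).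
Local Notation mR := (measurableTypeR R).

Lemma lipschitz_of_derive (f df : R -> R) (L : R) : 0 <= L ->
  (forall x, is_derive (x : R) (1 : R) f (df x)) -> (forall x, `|df x| <= L) ->
  forall x y, `|f x - f y| <= L * `|x - y|.
Proof.
move=> L0 fdf dfL.
suff h x y : x <= y -> `|f x - f y| <= L * `|x - y|.
  by move=> x y; have [/h//|/ltW/h] := leP x y; rewrite distrC [`|x - y|]distrC.
move=> xy; have cf : {within `[x, y], continuous f}.
  apply: continuous_subspaceT => z; apply/differentiable_continuous/derivable1_diffP.
  by have [] := fdf z.
have [c _ fxy] := @MVT_segment _ f df x y xy (fun z _ => fdf z) cf.
by rewrite distrC fxy normrM [`|x - y|]distrC ler_wpM2r.
Qed.

Lemma lipschitz_cosM (xi x y : R) : `|cos (xi * x) - cos (xi * y)| <= `|xi| * `|x - y|.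
Proof.
rewrite -normrM mulrBr -[leRHS]mul1r.
apply: (@lipschitz_of_derive cos (fun x => - sin x)) => // z.
by rewrite normrN sin_max.
Qed.

Lemma lipschitz_sinM (xi x y : R) : `|sin (xi * x) - sin (xi * y)| <= `|xi| * `|x - y|.
Proof.
rewrite -normrM mulrBr -[leRHS]mul1r.
by apply: (@lipschitz_of_derive sin cos) => // z; exact: cos_max.
Qed.

Lemma measurable_cosM (xi : R) : measurable_fun [set: mR] (fun x : R => cos (xi * x)).
Proof.
apply: continuous_measurable_fun => x; apply: continuous_comp.
  exact: mulrl_continuous.
exact: continuous_cos.
Qed.

Lemma measurable_sinM (xi : R) : measurable_fun [set: mR] (fun x : R => sin (xi * x)).
Proof.
apply: continuous_measurable_fun => x; apply: continuous_comp.
  exact: mulrl_continuous.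
exact: continuous_sin.
Qed.

(** The modulus of the Fourier transform of the law of which [q] is the quantile
    function. *)
Definition quantile_fourier (q : R -> R) (xi : R) : R :=
  Num.sqrt (quantile_mean q (fun x => cos (xi * x)) ^+ 2 +
            quantile_mean q (fun x => sin (xi * x)) ^+ 2).

Lemma normc_fourier_transform (mu : probability mR R) q
    (qm : {homo q : x y / x <= y}) xi :
  (forall B, measurable (B : set mR) -> mu B = quantile_law qm B) ->
  Normc.normc (fourier_transform mu xi) = quantile_fourier q xi.
Proof.
move=> muq.
have muI (g : R -> R) : measurable_fun [set: mR] g -> (forall x, `|g x| <= 1) ->
    \int[mu]_x g x = quantile_mean q g.
  move=> mg g1; rewrite -(Rintegral_quantile_law qm mg g1) /Rintegral.
  congr fine; apply: eq_measure_integral => B mB _; exact: muq.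
rewrite /fourier_transform /complex_integral /Normc.normc /quantile_fourier /=.
congr (Num.sqrt (_ + _)).
  rewrite -(muI (fun x => cos (xi * x))); last 2 first.
  - exact: measurable_cosM.
  - by move=> x; exact: cos_max.
  by congr (_ ^+ 2); apply: eq_Rintegral => x _; rewrite cosN.
rewrite -(muI (fun x => sin (xi * x))); last 2 first.
- exact: measurable_sinM.
- by move=> x; exact: sin_max.
rewrite -[RHS]sqrrN; congr (_ ^+ 2).
rewrite -[RHS]mulN1r -RintegralZl//; last first.
  apply: (bounded_integrable _ _ (measurable_sinM xi) (fun x => sin_max (xi * x))) => //.
  by rewrite (le_lt_trans (probability_le1 _ _)) ?ltry.
by apply: eq_Rintegral => x _; rewrite sinN mulN1r.
Qed.

(** The existence of a probability measure on [A] with Fourier decay [s / 2],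
    expressed through its quantile function [q]. *)
Definition quantile_decay (s c : R) (A : set R) := exists q : R -> R,
  [/\ {homo q : x y / x <= y}, forall t, 0 <= q t <= 1,
      forall t, 0 < t < 1 -> A (q t) &
      forall xi, xi != 0 -> quantile_fourier q xi <= c * `|xi| `^ (- (s / 2))].

(** Pointwise convergence is enough, even along a filter without a countable
    base, for which dominated convergence may fail: the uniform Riemann
    sums reduce the integrals to finitely many points. *)
Lemma cvg_quantile_mean (T : Type) (U : set_system T) (Q : T -> R -> R)
    (q g : R -> R) (L K : R) :
  ProperFilter U ->
  (\forall i \near U, {homo Q i : x y / x <= y} /\ forall t, 0 <= Q i t <= 1) ->
  {homo q : x y / x <= y} -> (forall t, 0 <= q t <= 1) ->
  (forall t, Q i t @[i --> U] --> q t) ->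
  measurable_fun [set: mR] g -> (forall x, `|g x| <= K) -> continuous g ->
  0 <= L -> (forall x y, `|g x - g y| <= L * `|x - y|) ->
  quantile_mean (Q i) g @[i --> U] --> quantile_mean q g.
Proof.
move=> PU UQ qm q01 Qq mg gK cg L0 gL.
apply/cvgrPdist_le => e e0.
pose N := Num.truncn (L * 3 / e).
have LN : L / N.+1%:R <= e / 3.
  rewrite ler_pdivrMr// mulrAC ler_pdivlMr// [e * _]mulrC -ler_pdivrMr//.
  exact: ltW (truncnS_gt _).
pose S (r : R -> R) := N.+1%:R^-1 * \sum_(i < N.+1) g (r (i%:R / N.+1%:R)).
have cS : S (Q i) @[i --> U] --> S q.
  apply: cvgMr; rewrite /=.
  apply: cvg_big => [|i _]; first exact: add_continuous.
  by apply: continuous_cvg => //; exact: cg.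
have /cvgrPdist_le/(_ (e / 3)) cSe := cS.
have e30 : 0 < e / 3 by rewrite divr_gt0.
near=> i.
have [Qm Q01] : {homo Q i : x y / x <= y} /\ forall t, 0 <= Q i t <= 1 by near: i.
have h1 := quantile_mean_riemann N Qm Q01 mg gK L0 gL.
have h2 := quantile_mean_riemann N qm q01 mg gK L0 gL.
have h3 : `|S q - S (Q i)| <= e / 3 by near: i; exact: cSe.
rewrite -/(S _) in h1; rewrite -/(S _) in h2.
move: (le_trans h1 LN) (le_trans h2 LN) h3.
rewrite !ler_norml; lra.
Unshelve. all: by end_near. Qed.

(** A limit point [A0] is the limit of an ultrafilter on the compact sets [A] in
    question; the pointwise limit of their quantile functions [Q A] is a
    quantile function for [A0]. *)
Lemma closed_quantile_decay s c : closed [set A : K01 R | quantile_decay s c A].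
Proof.
move=> A0; rewrite closureEcvg /= => -[G PG [GA0 DG]].
have [U [UU GU]] := ultraFilterLemma PG.
have PU : ProperFilter U by exact: ultra_proper.
have UA0 : U --> A0 by move=> B /GA0 /GU.
pose D := [set A : K01 R | quantile_decay s c A].
have UD : U D by apply: GU; apply: DG.
pose good (A : K01 R) (q : R -> R) := [/\ {homo q : x y / x <= y},
  forall t, 0 <= q t <= 1, forall t, 0 < t < 1 -> (A : set R) (q t) &
  forall xi, xi != 0 -> quantile_fourier q xi <= c * `|xi| `^ (- (s / 2))].
have /choice[Q QP] (A : K01 R) : exists q, D A -> good A q.
  by have [[q hq]|nD] := pselect (D A); [exists q|exists (fun=> 0)].
have /choice[q qP] t : exists l : R, `[0, 1]%classic l /\ Q A t @[A --> U] --> l.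
  have := @segment_compact R 0 1; rewrite compact_ultra.
  move=> /(_ _ (fmap_ultra (Q ^~ t) UU)).
  have UQ01 : U [set A | `[0, 1]%classic (Q A t)].
    by apply: filterS UD => A /QP [_ q01 _ _]; rewrite /= in_itv/=; exact: q01.
  by move=> /(_ UQ01) [l [l01 cl]]; exists l.
have q01 t : 0 <= q t <= 1 by have [] := qP t; rewrite /= in_itv/=.
have Qq t : Q A t @[A --> U] --> q t by have [] := qP t.
have qm : {homo q : x y / x <= y}.
  move=> x y xy; apply: (ler_cvg_to (Qq x) (Qq y)).
  by apply: filterS UD => A /QP [qm _ _ _]; exact: qm.
have UQ : \forall A \near U, {homo Q A : x y / x <= y} /\ forall t, 0 <= Q A t <= 1.
  by apply: filterS UD => A /QP [].
exists q; split => // [t t01|xi xi0].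
  (* otherwise a closed ball around [q t] would miss the compact sets near [A0] *)
  apply: contrapT => nA0.
  have : open (~` (A0 : set R)).
    apply: closed_openC; apply: compact_closed; first exact: Rhausdorff.
    exact: hyperspace_compact.
  rewrite openE => /(_ _ nA0) /nbhs_ballP[e /= e0 eA0].
  have e20 : 0 < e / 2 by rewrite divr_gt0.
  have UC : U [set A : K01 R | A `&` closed_ball (q t) (e / 2) = set0].
    apply: UA0; apply: open_nbhs_nbhs; split.
      by apply: open_vietoris_miss; exact: closed_ball_closed.
    rewrite /= -subset0 => x [A0x]; rewrite closed_ballE// /closed_ball_/= => xq.
    have /eA0 : ball (q t) e x 
      by rewrite /ball/= (le_lt_trans xq)// gtr_pMr// invf_lt1 ?ltr1n.
    exact.
  have UB : U [set A | ball (q t) (e / 2) (Q A t)].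
    by apply: (Qq t); apply: nbhsx_ballx.
  have [A [[DA /= AC] AB]] := filter_ex (filterI (filterI UD UC) UB).
  have [_ _ /(_ t t01) AQ _] := QP A DA.
  suff : (A `&` closed_ball (q t) (e / 2)) (Q A t) by rewrite AC.
  by split => //; exact: subset_closed_ball.
have ccos : quantile_mean (Q A) (fun x => cos (xi * x)) @[A --> U] -->
    quantile_mean q (fun x => cos (xi * x)).
  apply: (@cvg_quantile_mean _ _ _ _ _ `|xi| 1) => //.
  - exact: measurable_cosM.
  - by move=> x; exact: cos_max.
  - move=> x; apply: continuous_comp; first exact: mulrl_continuous.
    exact: continuous_cos.
  - by move=> x y; exact: lipschitz_cosM.
have csin : quantile_mean (Q A) (fun x => sin (xi * x)) @[A --> U] -->
    quantile_mean q (fun x => sin (xi * x)).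
  apply: (@cvg_quantile_mean _ _ _ _ _ `|xi| 1) => //.
  - exact: measurable_sinM.
  - by move=> x; exact: sin_max.
  - move=> x; apply: continuous_comp; first exact: mulrl_continuous.
    exact: continuous_sin.
  - by move=> x y; exact: lipschitz_sinM.
have cF : quantile_fourier (Q A) xi @[A --> U] --> quantile_fourier q xi.
  apply: continuous_cvg; first exact: sqrt_continuous.
  by apply: cvgD; [exact: (cvgM ccos ccos)|exact: (cvgM csin csin)].
apply: (closed_cvg (fun z : R => z <= c * `|xi| `^ (- (s / 2))) _ _ _ cF).
  exact: closed_le.
by apply: filterS UD => A /QP [_ _ _]; exact.
Qed.

(** * Fourier dimension *)

Lemma fourier_dim_gtP p (A : K01 R) : 0 <= p ->
  p < fourier_dim A <->
  exists s c, [/\ p < s <= 1, 0 < c & quantile_decay s c A].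
Proof.
move=> p0; rewrite /fourier_dim; set S := (X in sup X).
split => [pS|[s [c [/andP[ps s1] c0 [q [qm q01 qA qF]]]]]].
  have [s [/andP[_ s1] [mu muA [c c0 muF]]] ps] : exists2 s, S s & p < s.
    apply: (sup_gt _ pS); apply/set0P/eqP => S0.
    by move: pS; rewrite S0 sup0 ltNge p0.
  have mu01 : measure_support mu `<=` `[0, 1].
    by move=> x /muA; exact: hyperspace_sub.
  exists s, c; split; rewrite ?ps//; exists (clamped_quantile mu); split.
  - exact: clamped_quantile_homo.
  - exact: clamped_quantile01.
  - by move=> t t01; rewrite clamped_quantileE//; apply: muA; exact: quantile_support.
  - move=> xi xi0; apply: le_trans (muF xi xi0).
    by rewrite (normc_fourier_transform xi (quantile_law_clamped mu01)).
apply: (lt_le_trans ps); apply: ub_le_sup; first by exists 1 => x [/andP[]].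
split; first by rewrite s1 andbT (le_trans p0)// ltW.
exists (quantile_law qm).
  move=> x xs; apply: contrapT => nAx.
  have : open (~` (A : set R)).
    apply: closed_openC; apply: compact_closed; first exact: Rhausdorff.
    exact: hyperspace_compact.
  move=> /xs /(_ nAx).
  rewrite quantile_lawE (_ : _ `&` _ = set0) ?measure0 ?ltxx//.
  by rewrite -subset0 => t []/= nA; rewrite in_itv/= => /qA.
exists c => // xi xi0.
by rewrite (normc_fourier_transform (qm := qm))//; exact: qF.
Qed.

Lemma lebesgue01 : leb `]0%R, 1%R[ = 1%E.
Proof. by rewrite lebesgue_measure_itv/= lte_fin ltr01 oppr0 adde0. Qed.

Section mean.
Variables (q : R -> R).
Hypothesis qm : {homo q : x y / x <= y}.

Let integrable_mean (g : R -> R) (K : R) : measurable_fun [set: mR] g ->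
  (forall x, `|g x| <= K) -> leb.-integrable `]0, 1[ (EFin \o (g \o q)).
Proof.
move=> mg gK; apply: (@bounded_integrable _ leb _ _ K).
- exact: measurable_itv.
- by rewrite [ltLHS]lebesgue01 ltry.
- by apply: measurableT_comp => //; exact: monotone_measurable.
- by move=> t; exact: gK.
Qed.

Lemma quantile_mean_cst (c : R) : quantile_mean q (fun=> c) = c.
Proof.
have -> : quantile_mean q (fun=> c) = c * fine (leb `]0%R, 1%R[%classic).
  by apply: Rintegral_cst; exact: measurable_itv.
by rewrite lebesgue01 mulr1.
Qed.

Lemma le_quantile_mean (f g : R -> R) (K : R) :
  measurable_fun [set: mR] f -> measurable_fun [set: mR] g ->
  (forall x, `|f x| <= K) -> (forall x, `|g x| <= K) ->
  (forall x, f x <= g x) -> quantile_mean q f <= quantile_mean q g.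
Proof.
move=> mf mg fK gK fg; apply: le_Rintegral.
- exact: measurable_itv.
- exact: integrable_mean mf fK.
- exact: integrable_mean mg gK.
- by move=> t _; exact: fg.
Qed.

Lemma quantile_mean_norm_le (g : R -> R) (K : R) : measurable_fun [set: mR] g ->
  (forall x, `|g x| <= K) -> `|quantile_mean q g| <= K.
Proof.
move=> mg gK; have K0 : 0 <= K by exact: le_trans (gK 0).
rewrite ler_norml; apply/andP; split.
  rewrite -(quantile_mean_cst (- K)); apply: (@le_quantile_mean _ _ K) => //.
    by move=> x; rewrite normrN ger0_norm.
  by move=> x; have := gK x; rewrite ler_norml => /andP[].
rewrite -[leRHS]quantile_mean_cst; apply: (@le_quantile_mean _ _ K) => //.
  by move=> x; rewrite ger0_norm.
by move=> x; have := gK x; rewrite ler_norml => /andP[].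
Qed.

Lemma quantile_meanD (f g : R -> R) (K K' : R) :
  measurable_fun [set: mR] f -> measurable_fun [set: mR] g ->
  (forall x, `|f x| <= K) -> (forall x, `|g x| <= K') ->
  quantile_mean q (fun x => f x + g x) = quantile_mean q f + quantile_mean q g.
Proof.
move=> mf mg fK gK; apply: RintegralD.
- exact: measurable_itv.
- exact: integrable_mean mf fK.
- exact: integrable_mean mg gK.
Qed.

Lemma quantile_meanZ (g : R -> R) (K r : R) :
  measurable_fun [set: mR] g -> (forall x, `|g x| <= K) ->
  quantile_mean q (fun x => r * g x) = r * quantile_mean q g.
Proof.
move=> mg gK; apply: RintegralZl; first exact: measurable_itv.
exact: integrable_mean mg gK.
Qed.

Lemma quantile_mean_sum n (g : 'I_n -> R -> R) (K : R) :
  (forall i, measurable_fun [set: mR] (g i)) -> (forall i x, `|g i x| <= K) ->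
  quantile_mean q (fun x => \sum_(i < n) g i x) = \sum_(i < n) quantile_mean q (g i).
Proof.
elim: n g => [|n ih] g mg gK.
  rewrite big_ord0 -[RHS]quantile_mean_cst; congr quantile_mean.
  by apply/funext => x; rewrite big_ord0.
rewrite big_ord_recr/= -(ih (fun i => g (widen_ord (leqnSn n) i)))//.
rewrite -(@quantile_meanD _ _ (\sum_(i < n) K) K)//.
- by congr quantile_mean; apply/funext => x; rewrite big_ord_recr.
- by apply: measurable_sum => i; exact: mg.
- by move=> x; apply: le_trans (ler_norm_sum _ _ _) _; apply: ler_sum => i _; exact: gK.
Qed.

Lemma quantile_fourier_le (xi B : R) :
  `|quantile_mean q (fun x => cos (xi * x))| <= B ->
  `|quantile_mean q (fun x => sin (xi * x))| <= B ->
  quantile_fourier q xi <= B *+ 2.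
Proof.
move=> cB sB; have B0 : 0 <= B by exact: le_trans cB.
rewrite -[leRHS]ger0_norm ?mulrn_wge0// -sqrtr_sqr.
rewrite ler_sqrt ?sqr_ge0// -mulr_natl exprMn.
move: cB sB; set a := quantile_mean q _; set b := quantile_mean q _ => cB sB.
have : a ^+ 2 <= B ^+ 2 by rewrite -real_normK ?num_real// ler_sqr ?nnegrE.
have : b ^+ 2 <= B ^+ 2 by rewrite -[X in X <= _]real_normK ?num_real// ler_sqr ?nnegrE.
have := sqr_ge0 B; lra.
Qed.

Lemma quantile_fourier_ge_cos (xi : R) :
  `|quantile_mean q (fun x => cos (xi * x))| <= quantile_fourier q xi.
Proof.
by rewrite -sqrtr_sqr ler_sqrt ?lerDl ?sqr_ge0// addr_ge0 ?sqr_ge0.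
Qed.

Lemma quantile_fourier_ge_sin (xi : R) :
  `|quantile_mean q (fun x => sin (xi * x))| <= quantile_fourier q xi.
Proof.
by rewrite -sqrtr_sqr ler_sqrt ?lerDr ?sqr_ge0// addr_ge0 ?sqr_ge0.
Qed.

Lemma quantile_fourier_le2 (xi : R) : quantile_fourier q xi <= 2.
Proof.
apply: quantile_fourier_le; apply: quantile_mean_norm_le.
- exact: measurable_cosM.
- by move=> x; exact: cos_max.
- exact: measurable_sinM.
- by move=> x; exact: sin_max.
Qed.
End mean.

(** For [|xi| >= 1] a smaller exponent gives a weaker bound; for [|xi| < 1] the
    trivial bound 2 is good enough. *)
Lemma quantile_decay_le (s s' c : R) A : 0 <= s' <= s -> 0 <= c ->
  quantile_decay s c A -> quantile_decay s' (c + 2) A.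
Proof.
move=> /andP[s'0 s's] c0 [q [qm q01 qA qF]]; exists q; split => // xi xi0.
have xp : 0 < `|xi| by rewrite normr_gt0.
have [x1|x1] := leP 1 `|xi|.
  apply: le_trans (qF xi xi0) _; apply: ler_pM => //.
  - by rewrite lerDl.
  - by apply: ler_powR => //; rewrite lerN2 ler_wpM2r// invr_ge0.
apply: le_trans (quantile_fourier_le2 qm xi) _.
rewrite -[leLHS]mulr1; apply: ler_pM => //; first by rewrite lerDr.
rewrite -(powRr0 `|xi|); apply: ger_powR; first by rewrite xp ltW.
by rewrite oppr_le0 divr_ge0.
Qed.

Lemma quantile_decay_lec (s c c' : R) A : c <= c' ->
  quantile_decay s c A -> quantile_decay s c' A.
Proof.
move=> cc' [q [qm q01 qA qF]]; exists q; split => // xi xi0.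
by apply: le_trans (qF xi xi0) _; rewrite ler_wpM2r// powR_ge0.
Qed.

Lemma Sigma02_fourier_dim (p : R) : 0 <= p < 1 ->
  Sigma02 [set A : K01 R | p < fourier_dim A].
Proof.
move=> /andP[p0 p1].
rewrite (_ : mkset _ = \bigcup_i \bigcup_j
    [set A : K01 R | quantile_decay (p + (1 - p) / i.+1%:R) j.+1%:R A]).
  by apply: Fsigma_bigcup2 => i j; exact: closed_quantile_decay.
have p10 : 0 < 1 - p by rewrite subr_gt0.
apply/seteqP; split => A /=.
  move=> /(fourier_dim_gtP _ p0) [s [c [/andP[ps s1] c0 As]]].
  exists (Num.truncn ((1 - p) / (s - p))) => //.
  exists (Num.truncn (c + 2)) => //=.
  apply: (@quantile_decay_lec _ (c + 2)); first exact: ltW (truncnS_gt _).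
  apply: quantile_decay_le As; last exact: ltW.
  rewrite addr_ge0 ?divr_ge0 ?(ltW p10)//= -lerBrDl ler_pdivrMr//.
  by rewrite mulrC -ler_pdivrMr ?subr_gt0// ltW// truncnS_gt.
move=> [i _ [j _ Aij]]; apply/(fourier_dim_gtP _ p0).
exists (p + (1 - p) / i.+1%:R), j.+1%:R; split => //.
rewrite ltrDl divr_gt0//= -lerBrDl ler_pdivrMr// ler_peMr ?(ltW p10)//.
by rewrite ler1n.
Qed.

Lemma Rintegral01_derive (f F : R -> R) :
  (forall x, is_derive (x : R) (1 : R) F (f x)) -> continuous f ->
  \int[leb]_(t in `]0, 1[) f t = F 1 - F 0.
Proof.
move=> Ff cf.
have cF : continuous F.
  move=> z; apply/differentiable_continuous/derivable1_diffP.
  by have [] := Ff z.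
have cfw : {within `[0, 1], continuous f} by exact: continuous_subspaceT.
have icc : leb.-integrable `[0, 1] (EFin \o f).
  by apply: continuous_compact_integrable => //; exact: segment_compact.
rewrite Rintegral_itv_obnd_cbnd; last first.
  apply: integrableS icc; [exact: measurable_itv|exact: measurable_itv|].
  exact: subset_itv_oo_cc.
rewrite Rintegral_itv_bndo_bndc; last first.
  apply: integrableS icc; [exact: measurable_itv|exact: measurable_itv|].
  exact: subset_itv_co_cc.
rewrite /Rintegral (@continuous_FTC2 _ f F) => //.
- split => [x _||].
  + by have [] := Ff x.
  + by apply: cvg_at_right_filter; exact: cF.
  + by apply: cvg_at_left_filter; exact: cF.
- by move=> x _; rewrite derive1E; have [] := Ff x.
Qed.

(** The transform of the uniform law on [[a, b]] decays like [1 / |xi|], which is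
    the exponent [s = 2]; it is then lowered to [s = 1]. *)
Lemma interval_fourier_dim (p : R) (A : K01 R) (a b : R) :
  0 <= p < 1 -> a < b -> `[a, b] `<=` (A : set R) -> p < fourier_dim A.
Proof.
move=> /andP[p0 p1] ab abA; apply/(fourier_dim_gtP _ p0).
have h0 : 0 < b - a by rewrite subr_gt0.
exists 1, (4 / (b - a) + 2); split; first by rewrite p1 lexx.
  by rewrite addr_gt0// divr_gt0.
apply: (@quantile_decay_le 2); [by rewrite ler01 ler1n|by rewrite divr_ge0// ltW|].
pose q t := a + (b - a) * Num.max 0 (Num.min 1 t).
have qab t : a <= q t <= b.
  rewrite lerDl mulr_ge0 ?(ltW h0) ?le_max ?lexx//= -lerBrDl.
  by rewrite ler_piMr ?(ltW h0)// ge_max ler01 ge_min lexx.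
have qm : {homo q : x y / x <= y}.
  move=> x y xy; rewrite lerD2l ler_wpM2l ?(ltW h0)//.
  rewrite ge_max le_max lexx/= le_max; apply/orP; right.
  by rewrite le_min !ge_min lexx xy orbT.
have qE t : 0 < t < 1 -> q t = a + (b - a) * t.
  by move=> /andP[t0 t1]; rewrite /q (min_idPr (ltW t1)) (max_idPr (ltW t0)).
exists q; split => //.
- move=> t; have /hyperspace_sub : (A : set R) (q t).
    by apply: abA; rewrite /= in_itv/= qab.
  by rewrite /= in_itv.
- by move=> t _; apply: abA; rewrite /= in_itv/= qab.
move=> xi xi0.
have xh0 : xi * (b - a) != 0 by rewrite mulf_neq0// gt_eqF.
have meanE (g G : R -> R) :
    (forall x, is_derive (x : R) (1 : R) G (g x)) -> continuous g ->
    quantile_mean q (fun x => g (xi * x)) = (G (xi * b) - G (xi * a)) / (xi * (b - a)).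
  move=> Gg cg.
  transitivity (\int[leb]_(t in `]0, 1[) g (xi * (a + (b - a) * t))).
    by apply: eq_Rintegral => t; rewrite inE/= in_itv/= => /qE ->.
  pose phi t := xi * (a + (b - a) * t).
  have dphi (x : R) : is_derive x 1 phi (xi * (b - a)).
    by rewrite /phi; apply: is_derive_eq; rewrite /GRing.scale/=; ring.
  have dF (x : R) : is_derive x 1 ((xi * (b - a))^-1 \*: (G \o phi)) (g (phi x)).
    have dGphi : is_derive x 1 (G \o phi) (g (phi x) * (xi * (b - a))).
      exact: is_derive1_comp.
    apply: is_derive_eq.
    by rewrite /GRing.scale/=; field; rewrite xi0 subr_eq0 gt_eqF.
  have cgphi : continuous (g \o phi).
    move=> x; apply: continuous_comp; last exact: cg.
    by apply: differentiable_continuous; apply/derivable1_diffP; have [] := dphi x.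
  rewrite (Rintegral01_derive dF cgphi) /phi /=.
  by rewrite mulr0 mulr1 addr0 subrKC /GRing.scale/= -mulrBr mulrC.
have small (x y : R) : `|x| <= 1 -> `|y| <= 1 ->
    `|(x - y) / (xi * (b - a))| <= 2 / (b - a) * `|xi|^-1.
  move=> x1 y1; rewrite normrM normfV normrM (gtr0_norm h0) invfM.
  rewrite mulrCA [leRHS]mulrC ler_wpM2l ?invr_ge0 ?normr_ge0//.
  rewrite ler_wpM2r ?invr_ge0 ?(ltW h0)//.
  by apply: le_trans (ler_normB _ _) _; rewrite (_ : 2 = 1 + 1)// lerD.
rewrite mulfV ?pnatr_eq0// powR_inv1 ?normr_ge0//.
have -> : 4 / (b - a) * `|xi|^-1 = (2 / (b - a) * `|xi|^-1) *+ 2.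
  by rewrite -mulr_natl; ring.
apply: quantile_fourier_le.
  rewrite (meanE cos sin (@is_derive_sin R) (@continuous_cos R)).
  by apply: small; exact: sin_max.
have dcosN (x : R) : is_derive x 1 (- cos : R -> R) (sin x).
  by rewrite -[sin x]opprK; apply: is_deriveN.
rewrite (meanE sin _ dcosN (@continuous_sin R)).
by apply: small; rewrite normrN cos_max.
Qed.

(** The sum on the left is [|sum_j exp(i j x)|^2], a multiple of the Fejer kernel;
    the form on the right shows that it is nonnegative. *)
Lemma fejer_sum (N : nat) (x : R) :
  \sum_(j < N) \sum_(k < N) cos ((j%:R - k%:R) * x) =
  (\sum_(j < N) cos (j%:R * x)) ^+ 2 + (\sum_(j < N) sin (j%:R * x)) ^+ 2.
Proof.
rewrite !expr2 !big_distrlr -big_split/=; apply: eq_bigr => j _.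
rewrite -big_split/=; apply: eq_bigr => k _.
by rewrite mulrBl cosB.
Qed.

Lemma quantile_mean_cos_shift q (qm : {homo q : x y / x <= y}) (m a : R) :
  quantile_mean q (fun x => cos (m * (x - a))) <= quantile_fourier q m *+ 2.
Proof.
have -> : (fun x => cos (m * (x - a))) =
    (fun x => cos (m * a) * cos (m * x) + sin (m * a) * sin (m * x)).
  by apply/funext => x; rewrite mulrBr cosB mulrC [sin _ * _]mulrC.
have bnd (u v : R) : `|u| <= 1 -> `|v| <= 1 -> `|u * v| <= 1.
  by move=> u1 v1; rewrite normrM mulr_ile1.
rewrite (@quantile_meanD _ qm _ _ 1 1); last 4 first.
- by apply: measurable_funM => //; exact: measurable_cosM.
- by apply: measurable_funM => //; exact: measurable_sinM.
- by move=> x; apply: bnd; exact: cos_max.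
- by move=> x; apply: bnd; exact: sin_max.
rewrite (@quantile_meanZ _ qm _ 1)//;
  [|exact: measurable_cosM|by move=> x; exact: cos_max].
rewrite (@quantile_meanZ _ qm _ 1)//;
  [|exact: measurable_sinM|by move=> x; exact: sin_max].
have le_prod (u v w : R) : `|u| <= 1 -> `|v| <= w -> u * v <= w.
  move=> u1 vw; apply: le_trans (ler_norm _) _; rewrite normrM.
  by rewrite -[leRHS]mul1r; apply: ler_pM.
rewrite mulr2n lerD//; apply: le_prod; rewrite ?cos_max ?sin_max//.
  exact: quantile_fourier_ge_cos.
exact: quantile_fourier_ge_sin.
Qed.

Lemma powRN_small (s c e : R) : 0 < s -> 0 < c -> 0 < e ->
  exists2 M : R, 0 < M & forall x, M <= x -> c * x `^ (- s) <= e.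
Proof.
move=> s0 c0 e0; exists ((c / e) `^ s^-1); first by rewrite powR_gt0 ?divr_gt0.
move=> x Mx.
have M0 : 0 < (c / e) `^ s^-1 by rewrite powR_gt0 ?divr_gt0.
have x0 : 0 < x by exact: lt_le_trans Mx.
rewrite powRN ler_pdivrMr ?powR_gt0// mulrC -ler_pdivrMr//.
have <- : ((c / e) `^ s^-1) `^ s = c / e.
  by rewrite -powRrM mulVf ?gt_eqF// powRr1// divr_ge0 ?ltW.
by apply: ge0_ler_powR; rewrite ?nnegrE ?(ltW s0) ?(ltW M0) ?(ltW x0).
Qed.

(** Let [h] be the kernel [|sum_(j < N) exp(i j M (x - a))|^2]: it is nonnegative
    and equals [N^2] at [a], so the mass of [a] is at most the mean of [h] over
    [N^2]. Expanding the square, the [N] diagonal terms contribute 1 each. The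
    others are controlled by the Fourier transform at frequencies at least [M] in
    absolute value; they are at most [1 / N] when [M] is large. So the mass is
    at most [2 / N]. *)
Lemma quantile_decay_no_atom (s c : R) q (a : R) : 0 < s -> 0 < c ->
  {homo q : x y / x <= y} ->
  (forall xi, xi != 0 -> quantile_fourier q xi <= c * `|xi| `^ (- (s / 2))) ->
  leb (q @^-1` [set a] `&` `]0, 1[) = 0%E.
Proof.
move=> s0 c0 qm qF.
have mind : measurable_fun [set: mR] (\1_[set a] : R -> R).
  by apply: measurable_indic; exact: measurable_set1.
set E := _ `&` _.
have mE : measurable (E : set mR).
  apply: measurableI; last exact: measurable_itv.
  rewrite -[q @^-1` _]setTI.
  exact: (monotone_measurable qm measurableT (measurable_set1 a)).
have massE : quantile_mean q \1_[set a] = fine (leb E).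
  rewrite /quantile_mean /Rintegral; congr fine.
  rewrite -(integral_indic leb (measurable_itv `]0, 1[)); last first.
    rewrite -[q @^-1` _]setTI.
    exact: (monotone_measurable qm measurableT (measurable_set1 a)).
  by apply: eq_integral => t _; rewrite !indicE.
have leE1 : (leb E <= leb `]0%R, 1%R[%classic)%E.
  by apply: le_measure; rewrite ?inE// => t [].
have Efin : leb E = (fine (leb E))%:E.
  rewrite fineK// ge0_fin_numE ?measure_ge0//.
  by apply: le_lt_trans leE1 _; rewrite lebesgue01 ltry.
suff small n : fine (leb E) <= 2 / n.+1%:R.
  rewrite Efin; congr EFin; apply/eqP; rewrite eq_le fine_ge0 ?measure_ge0// andbT.
  rewrite leNgt; apply/negP => e0.
  have := small (Num.truncn (2 / fine (leb E))).
  rewrite leNgt => /negP; apply; rewrite ltr_pdivrMr// mulrC -ltr_pdivrMr//.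
  exact: truncnS_gt.
set N := n.+1.
have [M M0 hM] : exists2 M : R, 0 < M &
    forall x, M <= x -> (c *+ 2) * x `^ (- (s / 2)) <= N%:R^-1.
  apply: powRN_small; [by rewrite divr_gt0|by rewrite pmulrn_lgt0|].
  by rewrite invr_gt0 ltr0n.
pose h (x : R) := \sum_(j < N) \sum_(k < N) cos ((j%:R - k%:R) * M * (x - a)).
have hE x : h x = (\sum_(j < N) cos (j%:R * (M * (x - a)))) ^+ 2 +
                  (\sum_(j < N) sin (j%:R * (M * (x - a)))) ^+ 2.
  rewrite -fejer_sum; apply: eq_bigr => j _; apply: eq_bigr => k _.
  by rewrite mulrA.
have mcos (m : R) : measurable_fun [set: mR] (fun x : R => cos (m * (x - a))).
  apply: continuous_measurable_fun => x.
  apply: continuous_comp; last exact: continuous_cos.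
  by apply: cvgMr; apply: cvgB; [exact: cvg_id|exact: cvg_cst].
have cos1 (m : R) x : `|cos (m * (x - a))| <= 1 by exact: cos_max.
have sum1 : \sum_(k < N) (1 : R) = N%:R by rewrite sumr_const card_ord.
have mean_h : quantile_mean q h =
    \sum_(j < N) \sum_(k < N)
      quantile_mean q (fun x => cos ((j%:R - k%:R) * M * (x - a))).
  rewrite (@quantile_mean_sum _ qm _ _ N%:R).
  - by apply: eq_bigr => j _; rewrite (@quantile_mean_sum _ qm _ _ 1).
  - by move=> j; apply: measurable_sum => k; exact: mcos.
  - move=> j x; apply: le_trans (ler_norm_sum _ _ _) _.
    by rewrite -sum1; apply: ler_sum => k _.
have mh : measurable_fun [set: mR] h.
  by apply: measurable_sum => j; apply: measurable_sum => k; exact: mcos.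
have hN x : `|h x| <= N%:R ^+ 2.
  apply: le_trans (ler_norm_sum _ _ _) _.
  have -> : N%:R ^+ 2 = \sum_(j < N) N%:R :> R.
    by rewrite sumr_const card_ord -[RHS]mulr_natr expr2.
  apply: ler_sum => j _; apply: le_trans (ler_norm_sum _ _ _) _.
  by rewrite -sum1; apply: ler_sum.
have h_ge x : N%:R ^+ 2 * \1_[set a] x <= h x.
  rewrite indicE; have [xa|xa] := boolP (x \in [set a]); last first.
    by rewrite mulr0 hE addr_ge0 ?sqr_ge0.
  move: xa; rewrite inE/= => ->.
  rewrite mulr1 hE subrr mulr0.
  under eq_bigr do rewrite mulr0 cos0.
  by rewrite sum1 lerDl sqr_ge0.
have pair_le (j k : 'I_N) :
    quantile_mean q (fun x => cos ((j%:R - k%:R) * M * (x - a))) <= (j == k)%:R + N%:R^-1.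
  have [->|jk] := eqVneq j k.
    apply: le_trans (ler_norm _) _; apply: le_trans (quantile_mean_norm_le qm _ _) _.
    - exact: mcos.
    - exact: cos1.
    - by rewrite lerDl invr_ge0.
  rewrite add0r; apply: le_trans (quantile_mean_cos_shift qm _ _) _.
  have jk0 : (j%:R - k%:R : R) != 0 by rewrite subr_eq0 eqr_nat.
  have m0 : (j%:R - k%:R) * M != 0 by rewrite mulf_neq0// gt_eqF.
  apply: le_trans (_ : _ <= (c * `|(j%:R - k%:R) * M| `^ (- (s / 2))) *+ 2) _.
    by rewrite ler_pMn2r// qF.
  rewrite -mulrnAl; apply: hM.
  rewrite normrM (gtr0_norm M0) ler_peMl ?(ltW M0)//.
  have -> : (j%:R - k%:R : R) = ((j%:Z - k%:Z)%:~R) by rewrite rmorphB.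
  rewrite -intr_norm ler1z -gtz0_ge1 normr_gt0 subr_eq0.
  by apply: contra jk => /eqP [] /val_inj ->.
have N0 : (0 : R) < N%:R by rewrite ltr0n.
have mean_le : quantile_mean q h <= N%:R * 2.
  rewrite mean_h -sum1 mulr_suml; apply: ler_sum => j _.
  rewrite mul1r; apply: le_trans (_ : _ <= \sum_(k < N) ((j == k)%:R + N%:R^-1)) _.
    by apply: ler_sum => k _; exact: pair_le.
  rewrite big_split/= sumr_const card_ord -[N%:R^-1 *+ N]mulr_natr mulVf ?gt_eqF//.
  rewrite (bigD1 j)//= eqxx big1 ?addr0//.
  by move=> k; rewrite eq_sym => /negbTE ->.
have : N%:R ^+ 2 * fine (leb E) <= N%:R * 2.
  rewrite -massE; apply: le_trans mean_le.
  rewrite -(@quantile_meanZ _ qm _ 1)//; last first.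
    by move=> x; rewrite indicE; case: (_ \in _); rewrite ?normr0 ?normr1.
  apply: (@le_quantile_mean _ qm _ _ (N%:R ^+ 2)) => //.
  - by apply: measurable_funM.
  - move=> x; rewrite indicE; case: (_ \in _); rewrite ?mulr1 ?mulr0 ?normr0 ?sqr_ge0//.
    by rewrite ger0_norm ?sqr_ge0.
by rewrite expr2 -mulrA ler_pM2l// mulrC -ler_pdivlMr.
Qed.

Lemma countable_fourier_dim (p : R) (A : K01 R) :
  0 <= p -> countable (A : set R) -> ~ p < fourier_dim A.
Proof.
move=> p0 cA /(fourier_dim_gtP _ p0) [s [c [/andP[ps _] c0 [q [qm _ qA qF]]]]].
have s0 : 0 < s by exact: le_lt_trans ps.
have [f fA] := countable_enum cA.
pose E i := if f i is Some a then q @^-1` [set a] `&` `]0, 1[ else set0 : set R.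
have mE i : measurable (E i : set mR).
  rewrite /E; case: (f i) => [a|]; last exact: measurable0.
  apply: measurableI; last exact: measurable_itv.
  rewrite -[q @^-1` _]setTI.
  exact: (monotone_measurable qm measurableT (measurable_set1 a)).
have E0 i : leb (E i) = 0%E.
  rewrite /E; case: (f i) => [a|]; last exact: measure0.
  exact: quantile_decay_no_atom qF.
have : (leb `]0%R, 1%R[%classic <= \sum_(0 <= i <oo) leb (E i))%E.
  apply: measure_sigma_subadditive => //.
  move=> t /= t01; move: (t01); rewrite in_itv/= => /qA /fA [i fi].
  by exists i => //; rewrite /E fi.
by rewrite lebesgue01 eseries0 ?lte_fin// leNgt lte_fin ltr01.
Qed.
End fourier.

Theorem proposition3p7 (R : realType) (p : R) (hp : 0 <= p < 1) :
  complete_for R Sigma02 [set A : K01 R | (p%:E < hausdorff_dim A)%E] /\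
  complete_for R Sigma02 [set A : K01 R | p < fourier_dim A].
Proof.
have /andP[p0 _] := hp; split; split.
- apply: hard_of_countable_interval => [A|A a b ab].
    exact: countable_hausdorff_dim.
  exact: interval_hausdorff_dim.
- exact: Sigma02_hausdorff_dim.
- apply: hard_of_countable_interval => [A|A a b ab].
    exact: countable_fourier_dim.
  exact: interval_fourier_dim.
- exact: Sigma02_fourier_dim.
Qed.
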